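(* Let $d\geq 2$ be an integer, let $M\geq 1$, $s>1$ and $C_K>0$ be scalars, and let $B=[0,1]^d$. Let $K:\mathbb{R}\to\mathbb{C}$ be an analytic function that is bounded in absolute value on $[-dM,dM]$ by a constant $D_K\in(0,1]$, and that is analytically continuable to the open ellipse $E_s^{dM}$, where it satisfies $|K|\leq C_K$. Let $f$ be an arbitrary real-valued function in the space $\mathcal{H}_{K,M}(B)$, let $F=F_f$ be its associated function (both defined in the context), and let $$C_F=\int_{[-M,M]^d}|F(\boldsymbol{w})|\,d\boldsymbol{w}.$$ Then, for any measure $\mu$ on $B$ with $\mu(B)<\infty$ and any scalar $0<\epsilon<1$, there exists a deep ReLU network $\widetilde{f}$ with inputs $\boldsymbol{x}\in B=[0,1]^d$ that has depth $$L=\mathcal{O}\left(\frac{1}{\log_2^2 s}\,\log_2^2\frac{C_F C_K\sqrt{\mu(B)}}{\epsilon}\right)$$ and size $$W=\mathcal{O}\left(\frac{C_F^2\,\mu(B)}{\epsilon^2\log_2^2 s}\,\log_2^2\frac{C_F C_K\sqrt{\mu(B)}}{\epsilon}\right),$$ such that $$\left\Vert\widetilde{f}-f\right\Vert_{L^2(\mu,B)}=\sqrt{\int_B|\widetilde{f}(\boldsymbol{x})-f(\boldsymbol{x})|^2\,d\mu(\boldsymbol{x})}\leq\epsilon.$$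
   Context: **Generalized bandlimited functions.** For $d$, $M$, $B$, $K$ as in the claim, $$\mathcal{H}_{K,M}(B)=\left\{f(\boldsymbol{x})=\int_{[-M,M]^d}F(\boldsymbol{w})K(\boldsymbol{w}\cdot\boldsymbol{x})\,d\boldsymbol{w}\ \Big|\ F:[-M,M]^d\to\mathbb{C}\text{ is in }L^2([-M,M]^d)\right\},$$ a space of functions of $\boldsymbol{x}\in B$. For $f\in\mathcal{H}_{K,M}(B)$, let $S_f$ be the set of all $F\in L^2([-M,M]^d)$ such that $f(\boldsymbol{x})=\int_{[-M,M]^d}F(\boldsymbol{w})K(\boldsymbol{w}\cdot\boldsymbol{x})\,d\boldsymbol{w}$ for all $\boldsymbol{x}\in B$, and let $F_f=\arg\min_{F\in S_f}\|F\|_{L^2([-M,M]^d)}$. The space carries the inner product $\langle f,g\rangle_{\mathcal{H}_{K,M}(B)}=\int_{[-M,M]^d}F_f(\boldsymbol{w})\overline{F_g(\boldsymbol{w})}\,d\boldsymbol{w}$ and norm $\|f\|_{\mathcal{H}_{K,M}(B)}=\|F_f\|_{L^2([-M,M]^d)}$. The function $F=F_f$ is regarded as zero outside $[-M,M]^d$. **Ellipse.** For $A\geq1$ and $s>1$, $E_s^A$ is the open Bernstein $s$-ellipse scaled to $[-A,A]$: $$E_s^A=\left\{x+iy\in\mathbb{C}:\frac{x^2}{(a_s^A)^2}+\frac{y^2}{(b_s^A)^2}<1\right\},\quad a_s^A=A\frac{s+s^{-1}}{2},\quad b_s^A=A\frac{s-s^{-1}}{2}.$$ **Deep ReLU networks.**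 Let $\sigma(x)=\max(0,x)$. A deep ReLU network has input variables and units arranged in successive hidden layers; each unit computes $\sigma(\boldsymbol{w}\cdot\boldsymbol{z}+\theta)$ with real weights $\boldsymbol{w},\theta$, where $\boldsymbol{z}$ collects network inputs and outputs of units in preceding layers (connections between non-neighboring layers are allowed). The output is an affine combination (real coefficients) of the network inputs and the outputs of the units. The depth $L$ is the number of hidden layers and the size $W$ is the total number of units. **$\mathcal{O}$ convention.** Depth or size $\mathcal{O}(X)$ means it is at most $cX$, where $c$ may depend on $s$ but not on the other data ($d$, $M$, $K$, $C_K$, $f$, $C_F$, $\mu$, $\epsilon$). Inside $\mathcal{O}(\cdot)$, the logarithm $\log_2 t$ of the quantity $t$ containing $\epsilon$ is read as $\max\{1,\log_2 t\}$. *)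

(* Defs.v *)
From HB Require Import structures.
From mathcomp Require Import all_boot all_order all_algebra complex.
From mathcomp Require Import all_classical all_reals all_analysis.
Import Order.TTheory GRing.Theory Num.Theory numFieldNormedType.Exports.

Set Implicit Arguments.
Unset Strict Implicit.
Unset Printing Implicit Defensive.

Local Open Scope classical_set_scope.
Local Open Scope ring_scope.
Local Open Scope complex_scope.

(* Points of R^n are n-tuples: the library equips n.-tuple R with the product
   sigma-algebra of the Borel sigma-algebra of R, i.e. the Borel sigma-algebra
   of R^n. *)

Definition dotp (R : realType) (n : nat) (w x : n.-tuple R) : R :=
  \sum_(i < n) tnth w i * tnth x i.

Definition cube (R : realType) (n : nat) (a b : R) : set (n.-tuple R) :=
  [set x | forall i, a <= tnth x i <= b].

Section LebesgueTuple.
Context {R : realType}.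

Definition cons_pair (n : nat) (p : measurableTypeR R * n.-tuple R) :
  n.+1.-tuple R := [the n.+1.-tuple R of p.1 :: p.2].

Lemma measurable_cons_pair n : measurable_fun [set: _] (@cons_pair n).
Proof.
apply: (@measurable_cons _ _ (measurableTypeR R * n.-tuple R)%type R fst n snd).
- exact: (@measurable_fst _ _ (measurableTypeR R) (n.-tuple R)).
- exact: measurable_snd.
Qed.

Section Step.
Local Open Scope ereal_scope.
Variables (n : nat) (mu : {sigma_finite_measure set (n.-tuple R) -> \bar R}).

Definition lebesgue_cons : set (n.+1.-tuple R) -> \bar R :=
  pushforward (lebesgue_measure \x mu) (@cons_pair n).

Let lebesgue_cons0 : lebesgue_cons set0 = 0.
Proof. by rewrite /lebesgue_cons /pushforward preimage_set0 measure0. Qed.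

Let lebesgue_cons_ge0 A : 0 <= lebesgue_cons A.
Proof. by rewrite /lebesgue_cons /pushforward measure_ge0. Qed.

Let lebesgue_cons_sigma_additive : semi_sigma_additive lebesgue_cons.
Proof.
move=> F mF tF mUF; rewrite /lebesgue_cons /pushforward preimage_bigcup.
apply: measure_semi_sigma_additive.
- move=> k; rewrite -[X in measurable X]setTI.
  exact: measurable_cons_pair.
- apply/trivIsetP => /= i j _ _ ij; rewrite -preimage_setI.
  by move/trivIsetP : tF => /(_ _ _ _ _ ij) ->//; rewrite preimage_set0.
- rewrite -preimage_bigcup -[X in measurable X]setTI.
  exact: measurable_cons_pair.
Qed.

HB.instance Definition _ := isMeasure.Build _ _ _ lebesgue_cons
  lebesgue_cons0 lebesgue_cons_ge0 lebesgue_cons_sigma_additive.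

Let lebesgue_cons_sigma_finite : sigma_finite setT lebesgue_cons.
Proof.
have /sigma_finiteP[F [TF ndF Foo]] := sigma_finiteT (@lebesgue_measure R).
have /sigma_finiteP[G [TG ndG Goo]] := sigma_finiteT mu.
exists (fun k => [set t : n.+1.-tuple R |
    F k (thead t) /\ G k [tuple of behead t]]).
  apply/esym; rewrite -subTset => t _.
  have [i _ Fi] : (\bigcup_i F i) (thead t) by rewrite -TF.
  have [j _ Gj] : (\bigcup_j G j) [tuple of behead t] by rewrite -TG.
  exists (maxn i j) => //; split.
    by move: Fi; exact/subsetPset/ndF/leq_maxl.
  by move: Gj; exact/subsetPset/ndG/leq_maxr.
move=> k; have [mF Fy] := Foo k; have [mG Gy] := Goo k; split.
  apply: measurableI.
    by rewrite -[X in measurable X]setTI; exact: measurable_tnth.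
  by rewrite -[X in measurable X]setTI; exact: measurable_behead.
rewrite /lebesgue_cons /pushforward.
rewrite (_ : _ @^-1` _ = F k `*` G k).
  by rewrite product_measure1E// lte_mul_pinfty// ge0_fin_numE.
have consK (a : measurableTypeR R) (t : n.-tuple R) :
  [tuple of behead (cons_pair (a, t))] = t by exact/val_inj.
apply/seteqP; split=> -[a t] [Fa Gt]; split=> //.
  by move: Gt; rewrite consK.
by move: Gt; rewrite consK.
Qed.

HB.instance Definition _ := Measure_isSigmaFinite.Build _ _ _ lebesgue_cons
  lebesgue_cons_sigma_finite.

End Step.

(* Lebesgue measure on R^n, as an iterated product measure. *)
Fixpoint lebesgue_tuple (n : nat) :
    {sigma_finite_measure set (n.-tuple R) -> \bar R} :=
  match n with
  | 0 => \d_([tuple] : 0.-tuple R)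
  | m.+1 => lebesgue_cons (lebesgue_tuple m)
  end.

End LebesgueTuple.
Arguments lebesgue_tuple R n : clear implicits.

Section Complex.
Context {R : realType}.

Definition cmod (z : R[i]) : R := ComplexField.Normc.normc z.

Definition cintegral d (T : measurableType d) (mu : {measure set T -> \bar R})
    (D : set T) (g : T -> R[i]) : R[i] :=
  (\int[mu]_(x in D) complex.Re (g x)) +i* (\int[mu]_(x in D) complex.Im (g x)).

Definition l2norm d (T : measurableType d) (mu : {measure set T -> \bar R})
    (D : set T) (g : T -> R[i]) : \bar R :=
  sqrte (\int[mu]_(x in D) ((cmod (g x)) ^+ 2)%:E)%E.

Definition inL2 d (T : measurableType d) (mu : {measure set T -> \bar R})
    (D : set T) (g : T -> R[i]) : Prop :=
  [/\ measurable_fun D (fun x => complex.Re (g x)),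
      measurable_fun D (fun x => complex.Im (g x)) &
      (l2norm mu D g < +oo)%E].

Definition real_analytic (K : R -> R[i]) : Prop :=
  forall t0 : R, exists (r : R) (a : nat -> R[i]), 0 < r /\
    forall t : R, `|t - t0| < r ->
      series (fun n => a n * (t - t0)%:C ^+ n : R[i]^o) @ \oo
        --> (K t : R[i]^o).

Definition complex_analytic_on (U : set R[i]) (G : R[i] -> R[i]) : Prop :=
  forall z0 : R[i], U z0 -> exists (r : R) (a : nat -> R[i]), 0 < r /\
    forall z : R[i], cmod (z - z0) < r ->
      series (fun n => a n * (z - z0) ^+ n : R[i]^o) @ \oo
        --> (G z : R[i]^o).

Definition ellipse (A s : R) : set R[i] :=
  [set z | (complex.Re z) ^+ 2 / (A * ((s + s^-1) / 2)) ^+ 2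
         + (complex.Im z) ^+ 2 / (A * ((s - s^-1) / 2)) ^+ 2 < 1].

Definition continuable_to (U : set R[i]) (C : R) (K : R -> R[i]) : Prop :=
  exists G : R[i] -> R[i],
    [/\ complex_analytic_on U G,
        forall t : R, U t%:C -> G t%:C = K t &
        forall z : R[i], U z -> cmod (G z) <= C].

End Complex.

Section Bandlimited.
Context {R : realType}.
Variables (d : nat) (K : R -> R[i]) (M : R) (B : set (d.-tuple R)).

(* F \in S_f *)
Definition represents (f : d.-tuple R -> R[i]) (F : d.-tuple R -> R[i]) : Prop :=
  inL2 (lebesgue_tuple R d) (cube (- M) M) F /\
  forall x, B x ->
    f x = cintegral (lebesgue_tuple R d) (cube (- M) M)
            (fun w => F w * K (dotp w x)).

(* Elements of H_{K,M}(B) are functions on B: only the values of f on B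
   matter. *)
Definition bandlimited : set (d.-tuple R -> R[i]) :=
  [set f | exists F, represents f F].

(* F = F_f; the minimizer is unique up to a null set. *)
Definition minimal_representer (f F : d.-tuple R -> R[i]) : Prop :=
  represents f F /\
  forall F', represents f F' ->
    (l2norm (lebesgue_tuple R d) (cube (- M) M) F
       <= l2norm (lebesgue_tuple R d) (cube (- M) M) F')%E.

End Bandlimited.

Section ReLU.
Context {R : realType}.

Definition relu (x : R) : R := Num.max 0 x.

(* A network with n available values: either it outputs an affine combination
   of them, or a hidden layer of k units (weights, bias) is computed from them
   and the k new values become available, besides the n old ones, to all
   subsequent layers and to the output. *)
Inductive relu_net (n : nat) : Type :=
| Output of n.-tuple R & R
| Hidden (k : nat) of k.-tuple (n.-tuple R * R) & relu_net (n + k).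

Fixpoint relu_eval (n : nat) (N : relu_net n) : n.-tuple R -> R :=
  match N with
  | Output w b => fun z => dotp w z + b
  | Hidden k U N' => fun z =>
      relu_eval N' [tuple of z ++ [tuple of map (fun u => relu (dotp u.1 z + u.2)) U]]
  end.

Fixpoint relu_depth (n : nat) (N : relu_net n) : nat :=
  match N with
  | Output _ _ => 0
  | Hidden k _ N' => (relu_depth N').+1
  end.

Fixpoint relu_size (n : nat) (N : relu_net n) : nat :=
  match N with
  | Output _ _ => 0
  | Hidden k _ N' => (k + relu_size N')%N
  end.

Definition log2 (t : R) : R := ln t / ln 2.

(* log_2 t read as max {1, log_2 t}; as ln 0 = 0, it is 1 at t = 0. *)
Definition log2_1 (t : R) : R := Num.max 1 (log2 t).

End ReLU.
Arguments relu_net R n : clear implicits.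

(* Main.v *)
Require Import Defs.
From mathcomp Require Import all_boot all_order all_algebra complex.
From mathcomp Require Import all_classical all_reals all_analysis.
From mathcomp Require Import measurable_realfun ring lra.
Import Order.TTheory GRing.Theory Num.Theory numFieldNormedType.Exports.

(** Write [rho = C_F * sqrt (mu B) / eps].  If [rho <= 1] or [C_K * rho <= 1],
then [|f| <= C_F * min 1 C_K] already makes the zero network good enough.
Otherwise the network is obtained by two successive approximations.

Sampling ([sampling_mean]).  On the unit cube, [f] is the average of the
functions [C_F * Re (F w / |F w| * K (w . x))] for the probability density
[|F| / C_F] on the frequencies [w].  As in Maurey's lemma, some mean of
about [8 rho^2] of them is within [eps / 2] of [f] in [L^2(mu)].  The
frequencies are picked one after the other: if [S] is the sum of the errors
made so far and [g_w] denotes the function of frequency [w], then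
[(S + g_w - f)^2 <= S^2 + 2 (S - f) (g_w - f) + g_w^2], and by Fubini the
middle term has zero integral on average over [w], so that some [w] makes it
nonpositive up to an arbitrarily small amount.

Approximation of the kernel ([kernel_network]).  It remains to approximate
[Re (zeta * K t)], [|zeta| <= 1], for real [t] in [[-A, A]], [A = d M], with
uniform error about [1 / rho], by networks of depth and size
[O(log^2 (C_K rho))].  The ellipse contains the squares of half-width [A r]
centred on [[-A, A]], where [r] depends on [s] only.  On such a square the
Taylor coefficients of [K] satisfy [|a_k| <= C_K (2 / (A r))^k], and the
remainder of order [n] is at most [C_K (2 |u| / (A r))^n]
([taylor_square]).  No contour integral is needed: the slope
[(h z - h w) / (z - w)] of an analytic function is analytic, and by the
maximum principle on the square ([max_square]) it is bounded by twice the
bound of [h] divided by the half-width; this is iterated [n] times.  Hence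
[[-A, A]] splits into [J] pieces, [J] depending on [s] only, on each of which
[K] is within [C_K 2^-n] of a polynomial of degree less than [n] with
coefficients at most [C_K 2^-k] in a variable ranging over [[0, 1]].  The
pieces are glued without any partition of unity, by the telescoping identity
[f y + sum_(0 < j < J) f j = sum_(j < J) f (j + clamp01 (y - j))].

Powers of [v] in [[0, 1]] are computed one after the other by an approximate
product, based on the identity
[v p = (v + p) / 2 - 1/4 - e ((v + p) / 2) + e ((1 + v - p) / 2)] with
[e x = x (1 - x)], and on the fact that [e x = sum_(i >= 1) tooth^i x / 4^i],
where [tooth^i] is the [i]-th iterate of a piecewise linear function.  With
[n] proportional to [log (C_K rho)] all errors are small enough; each power
costs [O(n)] layers and units, hence [O(n^2)] for the whole polynomial. *)

Set Implicit Arguments.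
Unset Strict Implicit.
Unset Printing Implicit Defensive.

Local Open Scope classical_set_scope.
Local Open Scope ring_scope.
Local Open Scope complex_scope.

(** * The modulus and local power series *)

Section Modulus.
Variable R : realType.
Implicit Types (x y z : R[i]) (t : R).

Lemma cmodE z : `|z| = (cmod z)%:C.
Proof. by rewrite /cmod; case: z. Qed.

Lemma cmod_ge0 z : 0 <= cmod z.
Proof. by rewrite -ler0c -cmodE normr_ge0. Qed.

Lemma cmodM x y : cmod (x * y) = cmod x * cmod y.
Proof. exact: ComplexField.Normc.normcM. Qed.

Lemma cmodX x n : cmod (x ^+ n) = cmod x ^+ n.
Proof.
elim: n => [|n IH]; last by rewrite !exprS cmodM IH.
by rewrite !expr0; exact: ComplexField.Normc.normc1.
Qed.

Lemma cmodV x : cmod x^-1 = (cmod x)^-1.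
Proof. exact: ComplexField.Normc.normcV. Qed.

Lemma cmodN x : cmod (- x) = cmod x.
Proof. exact: normcN. Qed.

Lemma cmod0 : cmod (0 : R[i]) = 0.
Proof. exact: ComplexField.Normc.normc0. Qed.

Lemma cmod_eq0 x : (cmod x == 0) = (x == 0).
Proof.
apply/eqP/eqP => [|->]; [exact: ComplexField.Normc.eq0_normc | exact: cmod0].
Qed.

Lemma cmod_gt0 x : (0 < cmod x) = (x != 0).
Proof. by rewrite lt0r cmod_ge0 andbT cmod_eq0. Qed.

Lemma cmodD x y : cmod (x + y) <= cmod x + cmod y.
Proof. exact: le_normcD. Qed.

Lemma cmodB x y : cmod (x - y) <= cmod x + cmod y.
Proof. by rewrite -(cmodN y); exact: cmodD. Qed.

Lemma cmod_real t : cmod t%:C = `|t|.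
Proof. by rewrite /cmod /= expr0n /= addr0 sqrtr_sqr. Qed.

Lemma cmod_sum (I : Type) (s : seq I) (P : pred I) (f : I -> R[i]) :
  cmod (\sum_(i <- s | P i) f i) <= \sum_(i <- s | P i) cmod (f i).
Proof.
elim/big_ind2 : _ => [|x1 x2 y1 y2 h1 h2|//]; first by rewrite cmod0.
by rewrite (le_trans (cmodD _ _))// lerD.
Qed.

Lemma Re_le_cmod z : `|complex.Re z| <= cmod z.
Proof. by rewrite -lecR -cmodE normc_ge_Re. Qed.

Lemma Im_le_cmod z : `|complex.Im z| <= cmod z.
Proof.
rewrite /cmod; case: z => a b /=; rewrite -(sqrtr_sqr b) ler_wsqrtr//.
by rewrite lerDr sqr_ge0.
Qed.

End Modulus.

Section Expansions.
Variable R : realType.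
Implicit Types (h : R[i] -> R[i]) (z u w : R[i]) (a : nat -> R[i]) (C q : R).

(** [h (z + u)] is the sum of the power series with coefficients [a], in the
quantitative form of a geometric bound on all remainders in the disc
[q * |u| <= 1/2]. *)
Definition expands_at h z a C q : Prop :=
  0 < q /\ forall m u, q * cmod u <= 2^-1 ->
    cmod (h (z + u) - \sum_(k < m) a k * u ^+ k) <= C * (q * cmod u) ^+ m.

(** Existence of a power series expansion at [z], with no control on its radius. *)
Definition analytic_at h z : Prop := exists a C q, expands_at h z a C q.

Lemma expands_at_value h z a C q : expands_at h z a C q -> a 0%N = h z.
Proof.
case=> q0 H; have := H 1%N 0; rewrite cmod0 mulr0 invr_ge0 ler0n => /(_ isT).
rewrite addr0 big_ord1 !expr0n /= mulr0 mulr1 => le0.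
apply/esym/eqP; rewrite -subr_eq0 -cmod_eq0 eq_le cmod_ge0 andbT.
exact: le0.
Qed.

Lemma expands_at_coef h z a C q : expands_at h z a C q ->
  forall k, cmod (a k) <= 2 * C * q ^+ k.
Proof.
case=> q0 H k; pose u : R[i] := ((2 * q)^-1)%:C.
have cu : cmod u = (2 * q)^-1 by rewrite cmod_real ger0_norm// invr_ge0; nra.
have qu : q * cmod u = 2^-1 by rewrite cu invfM mulrCA divff ?mulr1 ?gt_eqF.
have := H k u; have := H k.+1 u; rewrite qu => /(_ (lexx _)) h1 /(_ (lexx _)) h2.
have C0 : 0 <= C.
  have := H 0%N 0; rewrite cmod0 mulr0 invr_ge0 ler0n expr0 mulr1 => /(_ isT).
  by apply: le_trans; exact: cmod_ge0.
have : cmod (a k * u ^+ k) <= 2 * C * (2^-1) ^+ k.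
  rewrite (_ : a k * _ = (h (z + u) - \sum_(i < k) a i * u ^+ i) -
     (h (z + u) - \sum_(i < k.+1) a i * u ^+ i)); last first.
    by rewrite big_ord_recr /=; ring.
  rewrite (le_trans (cmodB _ _))// (le_trans (lerD h2 h1))//.
  rewrite exprS; have : 0 <= C * 2^-1 ^+ k by rewrite mulr_ge0// exprn_ge0// invr_ge0.
  by move=> ?; lra.
rewrite cmodM cmodX cu -qu cu exprMn mulrA => h3.
by rewrite -(ler_pM2r (_ : 0 < (2 * q)^-1 ^+ k)) // exprn_gt0// invr_gt0; nra.
Qed.

Lemma expands_at_const_ge0 h z a C q : expands_at h z a C q -> 0 <= C.
Proof.
case=> q0 H.
have := H 0%N 0; rewrite cmod0 mulr0 invr_ge0 ler0n expr0 mulr1 => /(_ isT).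
by apply: le_trans; exact: cmod_ge0.
Qed.

Lemma analytic_continuous_at h z : analytic_at h z -> forall e : R, 0 < e ->
  exists2 dl : R, 0 < dl & forall u, cmod u < dl -> cmod (h (z + u) - h z) < e.
Proof.
move=> -[a [C [q He]]] e e0; have C0 := expands_at_const_ge0 He.
have a0 := expands_at_value He; have [q0 H] := He.
exists (Num.min (2 * q)^-1 (e / ((C + 1) * q))).
  rewrite lt_min invr_gt0 mulr_gt0//= divr_gt0// mulr_gt0//; lra.
move=> u; rewrite lt_min => /andP[u1 u2].
have qu : q * cmod u <= 2^-1.
  have := ltW u1; rewrite -(ler_pM2l q0) => /le_trans; apply.
  by rewrite invfM mulrCA divff ?mulr1 ?gt_eqF.
have := H 1%N u qu; rewrite big_ord1 expr0 mulr1 expr1 a0 => /le_lt_trans; apply.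
move: u2; rewrite ltr_pdivlMr; last by rewrite mulr_gt0//; lra.
have := cmod_ge0 u => cu0; have : 0 <= q * cmod u by rewrite mulr_ge0// ltW.
nra.
Qed.


(** The slope of [h] at [w], completed by the value [c] at [w]. *)
Definition slope h w (c : R[i]) z : R[i] :=
  if z == w then c else (h z - h w) / (z - w).

(** The expansion of the slope at its centre is the shifted expansion of [h]. *)
Lemma analytic_slope_center h w a C q : expands_at h w a C q ->
  analytic_at (slope h w (a 1%N)) w.
Proof.
move=> He; have a0 := expands_at_value He; have C0 := expands_at_const_ge0 He.
have [q0 H] := He.
exists (fun k => a k.+1), (C * q + cmod (a 1%N)), q; split => // m u qu.
have [->|u0] := eqVneq u 0.
  rewrite /slope addr0 eqxx cmod0 mulr0; case: m => [|m].
    by rewrite big_ord0 subr0 expr0 mulr1 lerDr mulr_ge0// ltW.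
  rewrite big_ord_recl expr0 mulr1 big1 ?addr0 ?subrr ?cmod0 ?expr0n ?mulr0//.
  by move=> i _; rewrite expr0n mulr0.
have -> : slope h w (a 1%N) (w + u) - \sum_(k < m) a k.+1 * u ^+ k =
    (h (w + u) - \sum_(k < m.+1) a k * u ^+ k) / u.
  rewrite /slope -subr_eq0 addrAC subrr add0r (negbTE u0) big_ord_recl expr0.
  rewrite mulr1 a0 opprD addrA (mulrBl _ (_ - _)); congr (_ - _).
  rewrite mulr_suml; apply: eq_bigr => i _.
  by rewrite lift0 exprS; field.
have cu : 0 < cmod u by rewrite cmod_gt0.
rewrite cmodM cmodV ler_pdivrMr//; apply: le_trans (H m.+1 u qu) _.
rewrite exprS mulrCA.
have : 0 <= (q * cmod u) ^+ m by rewrite exprn_ge0// mulr_ge0// ltW.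
move=> h1; have h2 := cmod_ge0 (a 1%N).
have : 0 <= (q * cmod u) ^+ m * (cmod (a 1%N) * cmod u).
  by rewrite mulr_ge0// mulr_ge0// ltW.
nra.
Qed.

(** Coefficients of the power series of [(\sum_k a k * u ^+ k) / (v + u)]. *)
Fixpoint quot_coef a (v : R[i]) (k : nat) : R[i] :=
  if k is j.+1 then (a k - quot_coef a v j) / v else a 0%N / v.

Lemma quot_coefE a v u m : v != 0 ->
  (v + u) * \sum_(k < m.+1) quot_coef a v k * u ^+ k =
  \sum_(k < m.+1) a k * u ^+ k + quot_coef a v m * u ^+ m.+1.
Proof.
move=> v0; elim: m => [|m IH].
  by rewrite !big_ord1 /= !expr0 expr1; field.
rewrite big_ord_recr mulrDr IH (big_ord_recr m.+1) /= !exprS.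
by field.
Qed.

Lemma quot_coef_bound a v (A B q p : R) : v != 0 ->
  0 < q -> q <= p -> 2 / cmod v <= p -> 2 * A / cmod v <= B ->
  (forall k, cmod (a k) <= A * q ^+ k) ->
  forall k, cmod (quot_coef a v k) <= B * p ^+ k.
Proof.
move=> v0 q0 qp vp AB Ha.
have cv : 0 < cmod v by rewrite cmod_gt0.
have A0 : 0 <= A.
  by have := Ha 0%N; rewrite expr0 mulr1; apply: le_trans; exact: cmod_ge0.
have B0 : 0 <= B.
  by apply: le_trans AB; apply: divr_ge0; [rewrite mulr_ge0|exact: ltW].
have p0 : 0 < p by exact: lt_le_trans qp.
have Hk k : 2 * cmod (a k) / cmod v <= B * p ^+ k.
  have e1 : q ^+ k <= p ^+ k by rewrite lerXn2r// nnegrE ltW.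
  apply: le_trans (_ : 2 * A / cmod v * p ^+ k <= _); last first.
    by rewrite ler_wpM2r// exprn_ge0// ltW.
  rewrite [leRHS]mulrAC ler_pM2r ?invr_gt0// -mulrA ler_pM2l//.
  by rewrite (le_trans (Ha k))// ler_wpM2l.
elim=> [|k IH] /=.
  rewrite cmodM cmodV; have := Hk 0%N; have := cmod_ge0 (a 0%N).
  have : 0 <= cmod (a 0%N) / cmod v by rewrite divr_ge0 ?cmod_ge0// ltW.
  by rewrite -mulrA; lra.
rewrite cmodM cmodV ler_pdivrMr//; apply: le_trans (cmodB _ _) _.
have := Hk k.+1; rewrite ler_pdivrMr// => h1.
have h2 : 2 <= p * cmod v by rewrite -ler_pdivrMr.
have h3 : 0 <= B * p ^+ k by rewrite mulr_ge0// exprn_ge0// ltW.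
move: h1; rewrite exprS.
nra.
Qed.

(** Away from the centre, the slope is the quotient of the series of [h - h w]
by [v + u], where [v = z - w]. *)
Lemma analytic_slope_off h w c z : z != w -> analytic_at h z -> analytic_at (slope h w c) z.
Proof.
move=> zw [a [C [q He]]]; have C0 := expands_at_const_ge0 He.
pose a' k := if k is 0 then a 0%N - h w else a k.
pose v := z - w; have v0 : v != 0 by rewrite subr_eq0.
have cv : 0 < cmod v by rewrite cmod_gt0.
have [q0 H] := He.
pose A := 2 * C + cmod (h w); have A0 : 0 <= A.
  by have := cmod_ge0 (h w); rewrite /A; lra.
have Ha' k : cmod (a' k) <= A * q ^+ k.
  case: k => [|k] /=.
    rewrite (le_trans (cmodB _ _))// /A expr0 mulr1 lerD2r.
    by have := expands_at_coef He 0%N; rewrite expr0 mulr1.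
  rewrite (le_trans (expands_at_coef He _))// /A ler_wpM2r ?exprn_ge0//.
    exact: ltW.
  by rewrite lerDl cmod_ge0.
(* This rate dominates that of [h] and makes [p * cmod u <= 1/2] imply
   [cmod u <= cmod v / 4], which keeps [v + u] away from [0]. *)
pose p := Num.max q (2 / cmod v).
pose B := 2 * A / cmod v.
have qp : q <= p by rewrite le_max lexx.
have vp : 2 / cmod v <= p by rewrite le_max lexx orbT.
have p0 : 0 < p by exact: lt_le_trans qp.
have Hb := quot_coef_bound v0 q0 qp vp (lexx B) Ha'.
have B0 : 0 <= B by apply: divr_ge0; [rewrite mulr_ge0|exact: ltW].
exists (quot_coef a' v), ((2 / cmod v) * (C + A + B)), p; split => // m u pu.
have cu0 := cmod_ge0 u.
have qu : q * cmod u <= 2^-1.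
  by apply: le_trans pu; rewrite ler_wpM2r.
have uv : cmod u <= cmod v / 4.
  have h4 : 2 / cmod v * cmod u <= 2^-1.
    by apply: le_trans pu; rewrite ler_wpM2r.
  rewrite ler_pdivlMr//; move: h4; rewrite mulrAC ler_pdivrMr//; lra.
have vu : cmod v / 2 <= cmod (v + u).
  have : cmod v <= cmod (v + u) + cmod u.
    by rewrite -{1}(addrK u v) (le_trans (cmodB _ _)).
  lra.
have vu0 : v + u != 0 by rewrite -cmod_gt0; lra.
have zuw : (z + u == w) = false.
  by apply/negbTE; rewrite -subr_eq0 addrAC.
rewrite /slope zuw.
have -> : z + u - w = v + u by rewrite /v; ring.
have key : cmod (h (z + u) - h w - (v + u) * \sum_(k < m) quot_coef a' v k * u ^+ k)
   <= (C + A + B) * (p * cmod u) ^+ m.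
  have pum : (q * cmod u) ^+ m <= (p * cmod u) ^+ m.
    have h1 : 0 <= q * cmod u by apply: mulr_ge0 => //; exact: ltW.
    have h2 : q * cmod u <= p * cmod u by exact: ler_wpM2r.
    by rewrite lerXn2r// nnegrE//; exact: le_trans h2.
  case: m pum => [|m] pum.
    rewrite big_ord0 mulr0 subr0 expr0 mulr1.
    have := H 0%N u qu; rewrite big_ord0 subr0 expr0 mulr1 => h1.
    rewrite (le_trans (cmodB _ _))//.
    have := cmod_ge0 (h w); rewrite /A; lra.
  rewrite quot_coefE//.
  have -> : h (z + u) - h w - (\sum_(k < m.+1) a' k * u ^+ k + quot_coef a' v m * u ^+ m.+1)
    = (h (z + u) - \sum_(k < m.+1) a k * u ^+ k) - quot_coef a' v m * u ^+ m.+1.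
    rewrite !big_ord_recl /= !expr0; ring.
  rewrite (le_trans (cmodB _ _))// (le_trans (lerD (H _ _ qu) (lexx _)))//.
  have h1 : C * (q * cmod u) ^+ m.+1 <= C * (p * cmod u) ^+ m.+1 by rewrite ler_wpM2l.
  have h2 : cmod (quot_coef a' v m * u ^+ m.+1) <= (A + B) * (p * cmod u) ^+ m.+1.
    rewrite cmodM cmodX exprMn mulrA ler_wpM2r ?exprn_ge0//.
    rewrite (le_trans (Hb m))// exprS mulrA.
    rewrite ler_wpM2r ?exprn_ge0 ?(ltW p0)//.
    have BE : B = A * (2 / cmod v) by rewrite /B; ring.
    have h5 : B <= A * p by rewrite BE ler_wpM2l.
    have h6 : 0 <= B * p by apply: mulr_ge0 => //; exact: ltW.
    lra.
  lra.
rewrite -(mulfK vu0 (\sum_(k < m) _)) -mulrBl cmodM cmodV [X in cmod (_ - X)]mulrC.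
rewrite ler_pdivrMr; last by rewrite cmod_gt0.
apply: le_trans key _.
have P0 : 0 <= (C + A + B) * (p * cmod u) ^+ m.
  by apply: mulr_ge0; [lra|apply/exprn_ge0/mulr_ge0 => //; exact: ltW].
rewrite (_ : _ * cmod (v + u) = (C + A + B) * (p * cmod u) ^+ m *
  (2 / cmod v * cmod (v + u))); last by ring.
rewrite ler_peMr// mulrAC ler_pdivlMr//; lra.
Qed.

Lemma analytic_slope h w : analytic_at h w -> exists c, forall z, analytic_at h z -> analytic_at (slope h w c) z.
Proof.
move=> [a [C [q He]]]; exists (a 1%N) => z hz.
have [->|zw] := eqVneq z w; first exact: analytic_slope_center He.
exact: analytic_slope_off.
Qed.

Lemma slopeE h w c u : h (w + u) = h w + u * slope h w c (w + u).
Proof.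
rewrite /slope -subr_eq0 addrAC subrr add0r; case: eqVneq => [->|u0].
  by rewrite addr0 mul0r addr0.
by field.
Qed.

End Expansions.

(** * The maximum principle on a square *)

Section MaximumPrinciple.
Variable R : realType.
Implicit Types (h : R[i] -> R[i]) (z u w : R[i]) (a : nat -> R[i]) (C q : R).

Lemma cmod_dist z w : `|cmod z - cmod w| <= cmod (z - w).
Proof.
have h1 : cmod z <= cmod (z - w) + cmod w by rewrite -{1}(subrK w z) cmodD.
have h2 : cmod w <= cmod (z - w) + cmod z.
  by rewrite -{1}(subKr z w) [leRHS]addrC; apply: cmodB.
by rewrite ler_norml; apply/andP; split; lra.
Qed.

Lemma cmod_le_ReIm z : cmod z <= `|complex.Re z| + `|complex.Im z|.
Proof.
rewrite {1}(complexE z) (le_trans (cmodD _ _))// cmodM !cmod_real.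
by rewrite {1}/cmod /= expr0n expr1n add0r sqrtr1 mul1r.
Qed.

(** Along [e], the term [b * u ^+ m.+1] is a nonnegative multiple of [a] (or
[a = 0]), so that the moduli add up. *)
Lemma aligned_direction (a b : R[i]) (m : nat) : b != 0 -> exists2 e : R[i], e != 0 &
  forall t : R, 0 <= t -> cmod (a + b * (t%:C * e) ^+ m.+1) =
    cmod a + cmod b * (t * cmod e) ^+ m.+1.
Proof.
move=> b0; have [->|a0] := eqVneq a 0.
  exists 1; first exact: oner_neq0.
  by move=> t t0; rewrite add0r cmod0 add0r cmodM cmodX cmodM cmod_real ger0_norm.
have [e He] : exists e : R[i], e ^+ m.+1 = a / b by exists (m.+1.-root (a / b)); rewrite rootCK.
have e0 : e != 0.
  apply: contraTneq (oner_neq0 R[i]) => e0; move: He; rewrite e0 expr0n /= => /eqP.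
  by rewrite eq_sym mulf_eq0 invr_eq0 (negbTE a0) (negbTE b0).
exists e => // t t0.
have h1 : b * (t%:C * e) ^+ m.+1 = (t ^+ m.+1)%:C * a.
  by rewrite exprMn He rmorphXn /=; field.
have h2 : cmod b * (t * cmod e) ^+ m.+1 = t ^+ m.+1 * cmod a.
  by rewrite exprMn -cmodX He cmodM cmodV; field; rewrite cmod_eq0.
rewrite h1 h2 (_ : a + _ = (1 + t ^+ m.+1)%:C * a); last first.
  by rewrite rmorphD /= mulrDl mul1r.
rewrite cmodM cmod_real ger0_norm; first ring.
by rewrite addr_ge0// exprn_ge0.
Qed.

(** Local form of the maximum principle: an analytic function is locally
constant, or its modulus takes larger values arbitrarily close. *)
Lemma analytic_local_max h z : analytic_at h z ->
  (exists2 dl : R, 0 < dl & forall u, cmod u < dl -> h (z + u) = h z) \/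
  (forall dl : R, 0 < dl -> exists2 u, cmod u < dl & cmod (h z) < cmod (h (z + u))).
Proof.
move=> [a [C [q He]]]; have C0 := expands_at_const_ge0 He.
have a0 := expands_at_value He; have [q0 H] := He.
have [Hall|Hex] := pselect (forall k, a k.+1 = 0).
  left; exists (2 * q)^-1; first by rewrite invr_gt0; lra.
  move=> u u1; have cu := cmod_ge0 u.
  have qu : q * cmod u < 2^-1.
    by move: u1; rewrite -(ltr_pM2l q0) invfM mulrCA divff ?mulr1 ?gt_eqF.
  have qu0 : 0 <= q * cmod u by apply: mulr_ge0 => //; exact: ltW.
  apply/eqP; rewrite -subr_eq0 -cmod_eq0 eq_le cmod_ge0 andbT.
  apply/ler_addgt0Pl => e e0; rewrite addr0.
  have /cvgrPdist_lt/(_ e e0) : (fun m => C * (q * cmod u) ^+ m) @ \oo --> (0 : R).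
    rewrite -[X in _ --> X](mulr0 C); apply: cvgMr; apply: cvg_expr.
    by rewrite ger0_norm//; lra.
  move=> [N _ HN]; have := HN N.+1 (leqnSn N); rewrite /= sub0r normrN.
  rewrite ger0_norm ?mulr_ge0 ?exprn_ge0// => /ltW; apply: le_trans.
  have := H N.+1 u (ltW qu); rewrite big_ord_recl /= expr0 mulr1 a0 big1 ?addr0//.
  by move=> i _; rewrite /bump leq0n add1n Hall mul0r.
right => dl dl0.
have {}Hex : exists k, a k.+1 != 0.
  by move/existsNP : Hex => -[k /eqP ak]; exists k.
pose m := ex_minn Hex; have [am0 amin] : a m.+1 != 0 /\ forall k, (k < m)%N -> a k.+1 = 0.
  rewrite /m; case: ex_minnP => k ak kmin; split => // j jk.
  by apply/eqP/negPn/negP => /kmin; rewrite leqNgt jk.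
have [e e0 Hdir] := aligned_direction (a 0%N) m am0.
have ce : 0 < cmod e by rewrite cmod_gt0.
have cam : 0 < cmod (a m.+1) by rewrite cmod_gt0.
(* The displacement has modulus [r], small enough for the remainder of order
   [m + 2] to be dominated by the first nonzero term. *)
pose D := C * q ^+ m.+2 + 1.
have D0 : 0 < D by rewrite /D; have := mulr_ge0 C0 (exprn_ge0 m.+2 (ltW q0)); lra.
pose r := Num.min (dl / 2) (Num.min (2 * q)^-1 (cmod (a m.+1) / (2 * D))).
have r0 : 0 < r.
  rewrite !lt_min; apply/and3P; split; first by rewrite divr_gt0.
    by rewrite invr_gt0 mulr_gt0.
  by rewrite divr_gt0// mulr_gt0.
have rdl : r < dl.
  rewrite /r gt_min (_ : dl / 2 < dl)//; lra.
have rq : q * r <= 2^-1.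
  have : r <= (2 * q)^-1 by rewrite !ge_min lexx !orbT.
  by rewrite -(ler_pM2l q0) => /le_trans; apply; rewrite invfM mulrCA divff ?mulr1 ?gt_eqF.
have rD : r * (2 * D) <= cmod (a m.+1).
  by rewrite -ler_pdivlMr ?mulr_gt0// !ge_min lexx !orbT.
pose u := (r / cmod e)%:C * e.
have cu : cmod u = r.
  rewrite cmodM cmod_real ger0_norm ?divr_ge0 ?(ltW r0) ?(ltW ce)//.
  by rewrite divfK// gt_eqF.
exists u; rewrite ?cu//.
pose b := a 0%N + a m.+1 * u ^+ m.+1.
have h1 : cmod (h (z + u) - b) <= C * (q * r) ^+ m.+2.
  have := H m.+2 u; rewrite cu => /(_ rq).
  rewrite big_ord_recr big_ord_recl /= expr0 mulr1 big1 ?addr0//.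
  by move=> i _; rewrite /bump leq0n add1n amin ?mul0r.
have h2 : cmod b = cmod (h z) + cmod (a m.+1) * r ^+ m.+1.
  rewrite /b /u Hdir ?divr_ge0 ?(ltW r0) ?(ltW ce)// a0 divfK//.
  by rewrite gt_eqF.
have h3 : cmod b <= cmod (h (z + u)) + cmod (h (z + u) - b).
  by rewrite -{1}(subKr (h (z + u)) b); exact: cmodB.
have rm : 0 < r ^+ m.+1 by rewrite exprn_gt0.
have h4 : C * (q * r) ^+ m.+2 < cmod (a m.+1) * r ^+ m.+1.
  have -> : C * (q * r) ^+ m.+2 = C * q ^+ m.+2 * r * r ^+ m.+1.
    by rewrite exprMn [r ^+ m.+2]exprS !mulrA.
  rewrite ltr_pM2r//.
  apply: lt_le_trans rD; rewrite /D.
  have : 0 <= C * q ^+ m.+2 by rewrite mulr_ge0// exprn_ge0// ltW.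
  nra.
lra.
Qed.

(** The closed square of half-width [rho] centred at [0]. *)
Definition in_square (rho : R) u := `|complex.Re u| <= rho /\ `|complex.Im u| <= rho.

Lemma in_square0 rho : 0 <= rho -> in_square rho 0.
Proof. by move=> ?; rewrite /in_square /= normr0. Qed.

Lemma analytic_continuous_pair h z : 
  forall p : R * R, analytic_at h (z + (p.1 +i* p.2)) ->
  {for p, continuous (fun p : R * R => cmod (h (z + (p.1 +i* p.2))))}.
Proof.
move=> p hp; apply/cvgrPdist_lt => e e0.
have [dl dl0 Hdl] := analytic_continuous_at hp e0.
have dl2 : 0 < dl / 2 by rewrite divr_gt0.
apply: filterS (nbhsx_ballx p (dl / 2) dl2) => p' [/= b1 b2].
have -> : z + (p'.1 +i* p'.2) = z + (p.1 +i* p.2) + ((p'.1 - p.1) +i* (p'.2 - p.2)).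
  rewrite -addrA; congr (_ + _); apply/eqP; rewrite eq_complex /=.
  by rewrite !(addrC _ (_ - _)) !subrK !eqxx.
rewrite distrC; apply: le_lt_trans (cmod_dist _ _) _; apply: Hdl.
apply: le_lt_trans (cmod_le_ReIm _) _ => /=.
rewrite distrC (distrC _ p.2) (splitr dl); exact: ltrD.
Qed.

(** Maximum principle.  The bound is only required at the points of the square
of modulus at least [rho], which include its boundary. *)
Lemma max_square h z (rho B : R) : 0 < rho ->
  (forall u, in_square rho u -> analytic_at h (z + u)) ->
  (forall u, in_square rho u -> rho <= cmod u -> cmod (h (z + u)) <= B) ->
  forall u, in_square rho u -> cmod (h (z + u)) <= B.
Proof.
move=> rho0 Hana Hbd.
pose f (p : R * R) := cmod (h (z + (p.1 +i* p.2))).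
pose A : set (R * R) := `[- rho, rho]%classic `*` `[- rho, rho]%classic.
have AE x y : A (x, y) <-> in_square rho (x +i* y).
  by rewrite /A /in_square /= !in_itv /= !ler_norml.
have A0 : A !=set0.
  by exists (0, 0); apply/AE; rewrite /in_square /= normr0; split; exact: ltW.
have Ac : compact A by apply: compact_setX; exact: segment_compact.
have fc : {within A, continuous f}.
  apply: continuous_in_subspaceT => -[x y] /set_mem/AE xy.
  exact/analytic_continuous_pair/Hana.
have [[x y] /set_mem/AE Axy Hmax] := compact_EVT_max A0 Ac fc.
have {}Hmax u : in_square rho u -> cmod (h (z + u)) <= cmod (h (z + (x +i* y))).
  by case: u => u1 u2 /AE/mem_set/Hmax.
have [Axr Ayr] := Axy; rewrite /= in Axr Ayr.
suff: cmod (h (z + (x +i* y))) <= B by move=> HB u /Hmax /le_trans; exact.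
have [yb|yb] := leP rho `|y|.
  by apply: Hbd => //; apply: le_trans yb _; exact: (Im_le_cmod (x +i* y)).
(* Among the maximizers on the horizontal line through [(x, y)], take the
   rightmost one: if it were interior, [h] could be neither constant nor
   nonconstant around it. *)
pose E := [set t : R | x <= t <= rho /\ cmod (h (z + (t +i* y))) = cmod (h (z + (x +i* y)))].
have Ex : E x by split => //; rewrite lexx /=; move: Axr; rewrite ler_norml => /andP[].
have Eub : has_sup E by split; [exists x|exists rho => t [/andP[]]].
pose t := sup E.
have xt : x <= t by apply: ub_le_sup => //; case: Eub.
have trho : t <= rho by apply: ge_sup; [exists x|move=> r [/andP[]]].
have At : in_square rho (t +i* y).
  split => //=; rewrite ler_norml trho andbT.
  by apply: le_trans xt; move: Axr; rewrite ler_norml => /andP[].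
have Et : cmod (h (z + (t +i* y))) = cmod (h (z + (x +i* y))).
  apply/eqP; rewrite eq_le Hmax//= leNgt; apply/negP => lt1.
  have gap : 0 < cmod (h (z + (x +i* y))) - cmod (h (z + (t +i* y))) by lra.
  have [dl dl0 Hdl] := analytic_continuous_at (Hana _ At) gap.
  have [r [/andP[r1 r2] r3] r4] := sup_adherent dl0 Eub; rewrite -/t in r4.
  have rt : r <= t by apply: ub_le_sup; [case: Eub|split => //; apply/andP].
  have := Hdl (r - t)%:C; rewrite cmod_real.
  have -> : `|r - t| < dl by rewrite ler0_norm; lra.
  move/(_ isT); have -> : z + (t +i* y) + (r - t)%:C = z + (r +i* y).
    rewrite -addrA; congr (_ + _); apply/eqP; rewrite eq_complex /=.
    by rewrite addrC subrK addr0 !eqxx.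
  have := cmod_dist (h (z + (r +i* y))) (h (z + (t +i* y))).
  rewrite r3 ger0_norm; lra.
have [tb|tb] := leP rho `|t|.
  by rewrite -Et; apply: Hbd => //; apply: le_trans tb _; exact: (Re_le_cmod (t +i* y)).
have [dl1 dl10 Hsub] : exists2 dl : R, 0 < dl &
    forall u, cmod u < dl -> in_square rho ((t +i* y) + u).
  exists (Num.min (rho - `|t|) (rho - `|y|)); first by rewrite lt_min !subr_gt0 tb.
  move=> [u1 u2]; rewrite lt_min => /andP[d1 d2].
  move: (Re_le_cmod (u1 +i* u2)) (Im_le_cmod (u1 +i* u2)) d1 d2.
  set c := cmod _ => /= e1 e2 d1 d2.
  by split; rewrite /= (le_trans (ler_normD _ _))//; lra.
case: (analytic_local_max (Hana _ At)) => [[dl dl0 Hc]|Hinc].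
  pose r := Num.min (Num.min dl dl1) (rho - t) / 2.
  have r0 : 0 < r.
    rewrite divr_gt0// !lt_min dl0 dl10 subr_gt0; move: tb; rewrite ltr_norml => /andP[_ ->//].
  have m1 : Num.min (Num.min dl dl1) (rho - t) <= dl by rewrite !ge_min lexx.
  have m2 : Num.min (Num.min dl dl1) (rho - t) <= rho - t by rewrite !ge_min lexx orbT.
  have r1 : r < dl by rewrite /r in r0 *; lra.
  have r2 : r < rho - t by rewrite /r in r0 *; lra.
  have : E (t + r).
    split; first by apply/andP; split; lra.
    rewrite -Et -(Hc r%:C); last by rewrite cmod_real gtr0_norm.
    congr (cmod (h _)); rewrite -addrA; congr (_ + _); apply/eqP; rewrite eq_complex /=.
    by rewrite addr0 !eqxx.
  move/(ub_le_sup (proj2 Eub)); rewrite -/t; lra.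
have [u u1 u2] := Hinc dl1 dl10.
have := Hmax _ (Hsub u u1); rewrite addrA -Et; lra.
Qed.

End MaximumPrinciple.

(** * Taylor approximation in the ellipse *)

Section Taylor.
Variable R : realType.
Implicit Types (h G : R[i] -> R[i]) (z u w : R[i]) (a : nat -> R[i]) (C q : R).

Lemma geometric_tail (x : R) m j : 0 <= x <= 2^-1 ->
  \sum_(i < j) x ^+ (m + i) <= 2 * x ^+ m.
Proof.
move=> /andP[x0 x1]; apply: (@le_trans _ _ (2 * x ^+ m - 2 * x ^+ (m + j))); last first.
  by rewrite lerBlDr lerDl mulr_ge0// exprn_ge0.
elim: j => [|j IH]; first by rewrite big_ord0 addn0 subrr.
rewrite big_ord_recr /= addnS exprS; have := exprn_ge0 (m + j) x0; nra.
Qed.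

(** Convergence of complex sequences in terms of [cmod]. *)
Lemma cvg_complexP (f : nat -> R[i]) (l : R[i]) :
  (f : nat -> R[i]^o) @ \oo --> (l : R[i]^o) ->
  forall e : R, 0 < e -> exists N, forall n, (N <= n)%N -> cmod (f n - l) < e.
Proof.
move=> /cvgrPdist_lt H e e0; have /H [N _ HN] : 0 < (e%:C : R[i]) by rewrite ltcR.
exists N => n /HN; rewrite /= cmodE ltcR -(cmodN (_ - _)) opprB; exact.
Qed.

(** A function that is the pointwise sum of a power series in a disc is
analytic at the centre in the sense of [analytic_at]. *)
Lemma analytic_of_series h z0 a (r : R) : 0 < r ->
  (forall z, cmod (z - z0) < r ->
    series (fun n => a n * (z - z0) ^+ n : R[i]^o) @ \oo --> (h z : R[i]^o)) ->
  analytic_at h z0.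
Proof.
move=> r0 Hs.
have Hcvg u : cmod u < r -> forall e : R, 0 < e -> exists N, forall n, (N <= n)%N ->
    cmod (\sum_(k < n) a k * u ^+ k - h (z0 + u)) < e.
  move=> ur; have := Hs (z0 + u); rewrite addrAC subrr add0r => /(_ ur) H.
  move=> e e0; have [N HN] := cvg_complexP H e0; exists N => n /HN.
  by rewrite /series /= big_mkord.
pose rho := r / 2; have rho0 : 0 < rho by rewrite divr_gt0.
have crho : cmod (rho%:C : R[i]) = rho by rewrite cmod_real gtr0_norm.
have [C C0 HC] : exists2 C : R, 0 <= C & forall k, cmod (a k) * rho ^+ k <= C.
  have [|N HN] := Hcvg rho%:C _ 1 ltr01; first by rewrite crho /rho; lra.
  exists (2 + \sum_(k < N) cmod (a k) * rho ^+ k).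
    by rewrite addr_ge0// sumr_ge0// => k _; rewrite mulr_ge0 ?cmod_ge0 ?exprn_ge0 ?ltW.
  move=> k; have [kN|Nk] := ltnP k N.
    rewrite (bigD1 (Ordinal kN)) //= addrCA lerDl addr_ge0//.
    by rewrite sumr_ge0// => i _; rewrite mulr_ge0 ?cmod_ge0 ?exprn_ge0 ?ltW.
  apply: (@le_trans _ _ 2); last first.
    by rewrite lerDl sumr_ge0// => i _; rewrite mulr_ge0 ?cmod_ge0 ?exprn_ge0 ?ltW.
  have -> : cmod (a k) * rho ^+ k = cmod (a k * rho%:C ^+ k) by rewrite cmodM cmodX crho.
  have -> : a k * rho%:C ^+ k =
    (\sum_(i < k.+1) a i * rho%:C ^+ i - h (z0 + rho%:C)) -
    (\sum_(i < k) a i * rho%:C ^+ i - h (z0 + rho%:C)).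
    by rewrite big_ord_recr /=; ring.
  rewrite (le_trans (cmodB _ _))//.
  have := HN _ Nk; have := HN k.+1 (leqW Nk); lra.
exists a, (2 * C), rho^-1; split; first by rewrite invr_gt0.
move=> m u qu; have cu0 := cmod_ge0 u.
have ur : cmod u < r by move: qu; rewrite mulrC ler_pdivrMr// /rho; lra.
apply/ler_addgt0Pl => e e0; have [N HN] := Hcvg u ur e e0.
have := HN (m + N)%N (leq_addl _ _).
rewrite big_split_ord /= => h1.
set S := \sum_(i < m) _ in h1 *; set T := \sum_(i < N) _ in h1.
have -> : h (z0 + u) - S = - (S + T - h (z0 + u)) + T by ring.
rewrite (le_trans (cmodD _ _))// cmodN; apply: lerD; first exact: ltW.
apply: le_trans (cmod_sum _ _ _) _.
apply: (@le_trans _ _ (C * \sum_(i < N) (rho^-1 * cmod u) ^+ (m + i))).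
  rewrite mulr_sumr ler_sum// => i _; rewrite cmodM cmodX exprMn mulrA.
  rewrite ler_wpM2r ?exprn_ge0// exprVn ler_pdivlMr ?exprn_gt0//; exact: HC.
rewrite (mulrC 2) -mulrA ler_wpM2l// geometric_tail// qu mulr_ge0// invr_ge0.
exact: ltW.
Qed.

Lemma analytic_on_at (U : set R[i]) G z0 : complex_analytic_on U G -> U z0 -> analytic_at G z0.
Proof. by move=> H /H [r [a [r0 Ha]]]; exact: analytic_of_series r0 Ha. Qed.

(** Cauchy estimates with [2 / rho] instead of [1 / rho], by iterating slopes: by
the maximum principle, the slope of a function bounded by [C] on the square
is bounded by [2 * C / rho]. *)
Lemma taylor_square n h z (rho C : R) : 0 < rho ->
  (forall u, in_square rho u -> analytic_at h (z + u)) ->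
  (forall u, in_square rho u -> cmod (h (z + u)) <= C) ->
  exists a : nat -> R[i], (forall k, (k < n)%N -> cmod (a k) <= C * (2 / rho) ^+ k) /\
  forall u, in_square rho u ->
    cmod (h (z + u) - \sum_(k < n) a k * u ^+ k) <= C * (2 / rho * cmod u) ^+ n.
Proof.
move=> rho0; elim: n h C => [|n IH] h C Hana HC.
  by exists (fun=> 0); split => // u Hu; rewrite big_ord0 subr0 expr0 mulr1; exact: HC.
have s0 : in_square rho 0 by apply: in_square0; exact: ltW.
have hz : analytic_at h z by have := Hana _ s0; rewrite addr0.
have Cz : cmod (h z) <= C by have := HC _ s0; rewrite addr0.
have [c Hc] := analytic_slope hz.
have [||b [Hb1 Hb2]] := IH (slope h z c) (C * (2 / rho)).
- by move=> u Hu; exact/Hc/Hana.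
- apply: max_square => // u Hu; first exact/Hc/Hana.
  move=> ru; rewrite /slope -subr_eq0 addrAC subrr add0r.
  have u0 : 0 < cmod u by exact: lt_le_trans ru.
  rewrite -cmod_eq0 gt_eqF// cmodM cmodV.
  have h1 : cmod (h (z + u) - h z) <= C * 2.
    by rewrite (le_trans (cmodB _ _))//; have := HC _ Hu; lra.
  by rewrite mulrA; apply: ler_pM => //; rewrite ?cmod_ge0 ?invr_ge0 ?cmod_ge0// lef_pV2.
exists (fun k => if k is j.+1 then b j else h z); split.
  case=> [_|k kn]; first by rewrite expr0 mulr1.
  by rewrite exprS mulrA; exact: Hb1.
move=> u Hu; rewrite big_ord_recl /= expr0 mulr1 (slopeE h z c).
rewrite (eq_bigr (fun i : 'I_n => u * (b i * u ^+ i))); last first.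
  by move=> i _; rewrite /bump leq0n add1n exprS mulrCA.
rewrite -mulr_sumr.
rewrite (_ : _ - _ = u * (slope h z c (z + u) - \sum_(k < n) b k * u ^+ k)); last first.
  by ring.
rewrite cmodM; apply: le_trans (ler_wpM2l (cmod_ge0 u) (Hb2 u Hu)) _.
by rewrite le_eqVlt exprS; apply/orP; left; apply/eqP; ring.
Qed.

(** Squares around the real points of the ellipse, with a half-width proportional
to [A]; the factor depends on [s] only. *)
Lemma square_in_ellipse (s : R) : 1 < s -> exists2 r : R, 0 < r &
  forall (A t0 : R) u, 0 < A -> `|t0| <= A -> in_square (A * r) u ->
    ellipse A s (t0%:C + u).
Proof.
move=> s1; set al := (s + s^-1) / 2; set be := (s - s^-1) / 2.
have s0 : 0 < s by lra.
have sV : s^-1 < 1 by rewrite invf_lt1.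
have b0 : 0 < be by rewrite /be; lra.
have ab : al ^+ 2 = be ^+ 2 + 1 by rewrite /al /be; field; lra.
have a0 : 0 < al by rewrite /al divr_gt0// addr_gt0// invr_gt0.
pose B := be ^+ 2; have B0 : 0 < B by rewrite exprn_gt0.
(* With [B = be ^+ 2] and [al ^+ 2 = B + 1], it suffices that
   [(1 + 3 * r) / (B + 1) + r / B < 1], i.e. [r * (4 * B + 1) < B ^+ 2]. *)
pose r := Num.min 1 (B ^+ 2 / (2 * (4 * B + 1))).
have D0 : 0 < 2 * (4 * B + 1) by lra.
have r0 : 0 < r by rewrite lt_min ltr01 divr_gt0 ?exprn_gt0.
have r1 : r <= 1 by rewrite ge_min lexx.
have r2 : r * (2 * (4 * B + 1)) <= B ^+ 2 by rewrite -ler_pdivlMr// ge_min lexx orbT.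
exists r => // A t0 [x y] A0 tA [/= xr yr].
rewrite /ellipse /= add0r -/al -/be (exprMn _ A al) (exprMn _ A be) ab -/B.
have AA : 0 < A ^+ 2 by rewrite exprn_gt0.
have h1 : (t0 + x) ^+ 2 <= A ^+ 2 * (1 + 3 * r).
  have : `|t0 + x| <= A * (1 + r) by rewrite (le_trans (ler_normD _ _))//; lra.
  move=> h; have : `|t0 + x| ^+ 2 <= (A * (1 + r)) ^+ 2.
    by rewrite lerXn2r// nnegrE mulr_ge0//; lra.
  rewrite real_normK ?num_real// => /le_trans; apply.
  rewrite exprMn ler_wpM2l ?(ltW AA)//; nra.
have h2 : y ^+ 2 <= A ^+ 2 * r.
  have : `|y| ^+ 2 <= (A * r) ^+ 2 by rewrite lerXn2r// nnegrE mulr_ge0// ltW.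
  rewrite real_normK ?num_real// => /le_trans; apply.
  rewrite exprMn ler_wpM2l ?(ltW AA)//; nra.
have h3 : (t0 + x) ^+ 2 / (A ^+ 2 * (B + 1)) <= (1 + 3 * r) / (B + 1).
  rewrite ler_pdivrMr; last by rewrite mulr_gt0//; lra.
  apply: le_trans h1 _; rewrite le_eqVlt; apply/orP; left; apply/eqP; field; lra.
have h4 : y ^+ 2 / (A ^+ 2 * B) <= r / B.
  rewrite ler_pdivrMr; last by rewrite mulr_gt0//; lra.
  apply: le_trans h2 _; rewrite le_eqVlt; apply/orP; left; apply/eqP; field; lra.
apply: le_lt_trans (lerD h3 h4) _.
have -> : (1 + 3 * r) / (B + 1) + r / B = (B + r * (4 * B + 1)) / (B * (B + 1)).
  by field; apply/andP; split; lra.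
rewrite ltr_pdivrMr ?mul1r; last by rewrite mulr_gt0//; lra.
have : 0 < B ^+ 2 by rewrite exprn_gt0.
nra.
Qed.

(** The segment [[- A, A]] is cut into [J] pieces of length [h = 2 * A / J], with
[h <= A * r / 4]; the [j]-th one is parametrized by [v] in [[0, 1]]. *)
Lemma kernel_taylor_pieces (s : R) : 1 < s -> exists2 J : nat, (0 < J)%N &
  forall (A C : R) (K : R -> R[i]), 0 < A -> continuable_to (ellipse A s) C K ->
  forall n, exists c : nat -> nat -> R[i],
    forall j, (j < J)%N ->
      (forall k, (k < n)%N -> cmod (c j k) <= C * 2^-1 ^+ k) /\
      forall v : R, 0 <= v <= 1 ->
        cmod (K (- A + 2 * A / J%:R * (j%:R + v)) - \sum_(k < n) c j k * v%:C ^+ k)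
          <= C * 2^-1 ^+ n.
Proof.
move=> s1; have [r r0 Hr] := square_in_ellipse s1.
have [J HJ] : exists J : nat, 8 / r <= J%:R.
  exists (Num.bound (8 / r)); apply/ltW; apply: le_lt_trans (archi_boundP _); first exact: lexx.
  by rewrite divr_ge0// ltW.
have J0 : 0 < (J%:R : R) by apply: lt_le_trans HJ; rewrite divr_gt0.
exists J; first by rewrite -(ltr_nat R).
move=> A C K A0 [G [anaG GK Gbd]] n.
have [h hE] : exists h : R, h = 2 * A / J%:R by eexists.
have h0 : 0 < h by rewrite hE divr_gt0// mulr_gt0.
have hA : h <= A * r / 4.
  rewrite hE ler_pdivrMr//; move: HJ; rewrite ler_pdivrMr//; nra.
have inA (x : R) : 0 <= x <= J%:R -> `|- A + h * x| <= A.
  move=> /andP[x0 xJ]; have hJ : h * J%:R = 2 * A by rewrite hE divfK// gt_eqF.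
  have : h * x <= h * J%:R by rewrite ler_pM2l.
  have : 0 <= h * x by rewrite mulr_ge0// ltW.
  by rewrite ler_norml => ? ?; apply/andP; split; lra.
have piece j : (j < J)%N -> exists a : nat -> R[i],
    (forall k, (k < n)%N -> cmod (a k) <= C * (2 / (A * r)) ^+ k) /\
    forall u, in_square (A * r) u -> cmod (G ((- A + h * j%:R)%:C + u) - \sum_(k < n) a k * u ^+ k)
       <= C * (2 / (A * r) * cmod u) ^+ n.
  move=> jJ; have tA : `|- A + h * j%:R| <= A.
    by apply: inA; rewrite ler0n ler_nat ltnW.
  apply: taylor_square; first by rewrite mulr_gt0.
    by move=> u Hu; apply: analytic_on_at anaG _; exact: Hr.
  by move=> u Hu; apply: Gbd; exact: Hr.
have /choice[a Ha] j : exists b : nat -> R[i], (j < J)%N ->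
    (forall k, (k < n)%N -> cmod (b k) <= C * (2 / (A * r)) ^+ k) /\
    forall u, in_square (A * r) u ->
      cmod (G ((- A + h * j%:R)%:C + u) - \sum_(k < n) b k * u ^+ k)
        <= C * (2 / (A * r) * cmod u) ^+ n.
  have [jJ|_] := boolP (j < J)%N; last by exists (fun=> 0).
  by have [b Hb] := piece j jJ; exists b.
have C0 : 0 <= C.
  have := Gbd 0; have := Hr A 0 0 A0; rewrite normr0 addr0 => /(_ (ltW A0)) H1.
  move=> H2; apply: le_trans (cmod_ge0 _) (H2 _); apply/H1/in_square0.
  by rewrite mulr_ge0// ltW.
have Ar0 : 0 < A * r by rewrite mulr_gt0.
have hq : 0 <= 2 / (A * r) * h <= 2^-1.
  apply/andP; split; first by apply: mulr_ge0; [apply: divr_ge0 => //|]; exact: ltW.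
  by rewrite mulrAC ler_pdivrMr//; lra.
have hC k (x : R) : 0 <= x <= 2^-1 -> C * x ^+ k <= C * 2^-1 ^+ k.
  by move=> /andP[x0 x1]; rewrite ler_wpM2l// lerXn2r// nnegrE.
exists (fun j k => a j k * h%:C ^+ k) => j jJ; have [Ha1 Ha2] := Ha j jJ; split.
  move=> k kn; rewrite cmodM cmodX cmod_real (gtr0_norm h0).
  apply: le_trans (hC k _ hq); rewrite (exprMn _ (2 / (A * r)) h) mulrA ler_wpM2r ?exprn_ge0 ?(ltW h0)//.
  exact: Ha1.
move=> v /andP[v0 v1].
have hv : in_square (A * r) (h * v)%:C.
  split => /=; last by rewrite normr0 ltW.
  by rewrite ger0_norm ?mulr_ge0 ?(ltW h0)//; nra.
have := Ha2 _ hv; rewrite -rmorphD.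
have tE : - A + h * j%:R + h * v = - A + h * (j%:R + v) by ring.
have jv : `|- A + h * (j%:R + v)| <= A.
  apply: inA; rewrite addr_ge0//=; apply: (@le_trans _ _ (j.+1)%:R).
    by rewrite -natr1 lerD2l.
  by rewrite ler_nat.
rewrite tE GK; last first.
  rewrite -(addr0 (_ %:C)); apply: Hr => //.
  by apply: in_square0; exact: ltW.
move=> H; rewrite -hE (eq_bigr (fun k : 'I_n => a j k * (h * v)%:C ^+ k)); last first.
  by move=> k _; rewrite rmorphM -mulrA -exprMn.
apply: le_trans H _; apply: le_trans (hC n _ hq).
rewrite cmod_real ger0_norm ?mulr_ge0 ?(ltW h0)//.
move: hq => /andP[hq0 _].
rewrite ler_wpM2l// lerXn2r// ?nnegrE//; last by rewrite mulrA ler_piMr.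
by rewrite mulrA mulr_ge0.
Qed.

Lemma continuable_continuous (s A C : R) (K : R -> R[i]) : 1 < s -> 0 < A ->
  continuable_to (ellipse A s) C K ->
  forall t : R, `|t| <= A -> forall e : R, 0 < e -> exists2 dl : R, 0 < dl &
    forall t' : R, `|t'| <= A -> `|t' - t| < dl -> cmod (K t' - K t) < e.
Proof.
move=> s1 A0 [G [anaG GK _]] t tA e e0; have [r r0 Hr] := square_in_ellipse s1.
have inU (x : R) : `|x| <= A -> ellipse A s x%:C.
  move=> xA; rewrite -(addr0 (_ %:C)); apply: Hr => //; apply: in_square0.
  by rewrite mulr_ge0// ltW.
have [dl dl0 Hdl] := analytic_continuous_at (analytic_on_at anaG (inU t tA)) e0.
exists dl => // t' t'A tt; have := Hdl (t' - t)%:C; rewrite cmod_real => /(_ tt).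
by rewrite -rmorphD /= (addrC t) subrK !GK//; exact: inU.
Qed.

Lemma continuable_bound (s A C : R) (K : R -> R[i]) : 1 < s -> 0 < A ->
  continuable_to (ellipse A s) C K -> forall t : R, `|t| <= A -> cmod (K t) <= C.
Proof.
move=> s1 A0 [G [_ GK Gbd]] t tA; have [r r0 Hr] := square_in_ellipse s1.
have inU : ellipse A s t%:C.
  rewrite -(addr0 (_ %:C)); apply: Hr => //; apply: in_square0.
  by rewrite mulr_ge0// ltW.
by rewrite -GK//; exact: Gbd.
Qed.

End Taylor.

(** * Computing functions by layers of ReLU units *)

Section Schedules.
Variables (R : realType) (T : Type).
Local Notation fn := (T -> R).
Implicit Types (V S : set fn) (f g h : fn) (l : seq fn) (ls : seq (seq fn)).

(** The affine span of a set of real functions. *)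
Inductive aff V : set fn :=
| aff_gen f : V f -> aff V f
| aff_cst b : aff V (fun=> b)
| aff_add f g : aff V f -> aff V g -> aff V (fun x => f x + g x)
| aff_scale a f : aff V f -> aff V (fun x => a * f x).

Lemma aff_trans V S : V `<=` aff S -> aff V `<=` aff S.
Proof.
move=> VS f; elim => {f} [f /VS//|b|f g _ + _|a f _].
- exact: aff_cst.
- exact: aff_add.
- exact: aff_scale.
Qed.

Lemma affS V S : V `<=` S -> aff V `<=` aff S.
Proof. by move=> VS; apply: aff_trans => f /VS; exact: aff_gen. Qed.

Lemma aff_sum V (I : Type) (r : seq I) (F : I -> fn) :
  (forall i, aff V (F i)) -> aff V (fun x => \sum_(i <- r) F i x).
Proof.
move=> VF; elim: r => [|i r IH].
  rewrite (_ : (fun x => _) = fun=> 0); first exact: aff_cst.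
  by apply/funext => x; rewrite big_nil.
rewrite (_ : (fun x => _) = fun x => F i x + \sum_(i <- r) F i x).
  exact: aff_add.
by apply/funext => x; rewrite big_cons.
Qed.

Lemma aff_sum_ord V n (F : nat -> fn) :
  (forall i, (i < n)%N -> aff V (F i)) -> aff V (fun x => \sum_(i < n) F i x).
Proof.
elim: n => [|n IH] VF.
  rewrite (_ : (fun x => _) = fun=> 0); first exact: aff_cst.
  by apply/funext => x; rewrite big_ord0.
rewrite (_ : (fun x => _) = fun x => \sum_(i < n) F i x + F n x).
  apply: aff_add; last exact: VF.
  by apply: IH => i ni; apply: VF; exact: leqW.
by apply/funext => x; rewrite big_ord_recr.
Qed.

Lemma aff_sub V f g : aff V f -> aff V g -> aff V (fun x => f x - g x).
Proof.
move=> Vf Vg; rewrite (_ : (fun x => _) = fun x => f x + -1 * g x).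
  by apply: aff_add => //; exact: aff_scale.
by apply/funext => x; rewrite mulN1r.
Qed.

(** The layers [ls] can be computed in this order from the functions of [V]: each
function is a ReLU unit applied to an affine combination of the functions of
[V] and of the preceding layers. *)
Fixpoint schedule V ls : Prop :=
  if ls is l :: ls' then
    (forall g, g \in l -> exists2 h, aff V h & g = fun x => relu (h x)) /\
    schedule (V `|` [set` l]) ls'
  else True.

Lemma scheduleS V S ls : V `<=` aff S -> schedule V ls -> schedule S ls.
Proof.
elim: ls V S => //= l ls IH V S VS [Hl Hls]; split.
  by move=> g /Hl [h Vh ->]; exists h => //; exact: aff_trans Vh.
apply: IH Hls => f [/VS|fl]; last by apply: aff_gen; right.
by apply: affS => g; left.
Qed.

Lemma schedule_rcons V ls l : schedule V ls ->
  (forall g, g \in l -> exists2 h, aff (V `|` [set` flatten ls]) h & g = fun x => relu (h x)) ->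
  schedule V (rcons ls l).
Proof.
elim: ls V => [|k ls IH] V /=.
  move=> _ Hl; split => // g /Hl [h Vh ->]; exists h => //.
  by apply: affS Vh => f [].
move=> [Hk Hls] Hl; split => //; apply: IH => // g /Hl [h Vh ->]; exists h => //.
apply: affS Vh => f [Vf|/=]; first by left; left.
by rewrite mem_cat => /orP[fk|fl]; [left; right|right].
Qed.

(** Juxtaposition of two sequences of layers of the same length, layer by layer. *)
Fixpoint parallel ls ms : seq (seq fn) :=
  match ls, ms with
  | l :: ls', m :: ms' => (l ++ m) :: parallel ls' ms'
  | _, _ => [::]
  end.

Lemma size_parallel ls ms : size ls = size ms -> size (parallel ls ms) = size ls.
Proof. by elim: ls ms => [|l ls IH] [|m ms]//= [] /IH ->. Qed.

Lemma perm_parallel ls ms : size ls = size ms ->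
  perm_eq (flatten (parallel ls ms)) (flatten ls ++ flatten ms).
Proof.
elim: ls ms => [|l ls IH] [|m ms]//= [] /IH H.
rewrite -!catA perm_cat2l perm_sym perm_catCA perm_cat2l perm_sym; exact: H.
Qed.

Lemma schedule_parallel V ls ms : size ls = size ms ->
  schedule V ls -> schedule V ms -> schedule V (parallel ls ms).
Proof.
elim: ls ms V => [|l ls IH] [|m ms]//= V [] sz [Hl Hls] [Hm Hms]; split.
  by move=> g; rewrite mem_cat => /orP[/Hl|/Hm].
apply: IH => //.
  apply: scheduleS Hls => f [Vf|fl]; apply: aff_gen; [by left|right].
  by rewrite /= mem_cat fl.
apply: scheduleS Hms => f [Vf|fl]; apply: aff_gen; [by left|right].
by rewrite /= mem_cat (_ : f \in m) ?orbT.
Qed.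

(** From the functions of [V], [L] layers with [W] units in total give access to
all functions of [S] as affine combinations of inputs and units. *)
Definition computes V (L W : nat) S : Prop := exists ls,
  [/\ size ls = L, size (flatten ls) = W, schedule V ls &
      S `<=` aff (V `|` [set` flatten ls])].

Lemma computes_input V : computes V 0 0 V.
Proof. by exists [::]; split => // f Vf; apply: aff_gen; left. Qed.

Lemma computes_aff V L W S S' : computes V L W S -> S' `<=` aff S -> computes V L W S'.
Proof.
move=> [ls [sL sW Hls HS]] SS; exists ls; split => // f /SS; exact: aff_trans.
Qed.

Lemma computes_layer V L W S l : computes V L W S -> (forall g, g \in l -> aff S g) ->
  computes V L.+1 (W + size l)
    (S `|` [set g | exists2 h, h \in l & g = fun x => relu (h x)]).
Proof.
move=> [ls [sL sW Hls HS]] Hl.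
exists (rcons ls [seq (fun x => relu (h x)) | h <- l]); split.
- by rewrite size_rcons sL.
- by rewrite -cats1 flatten_cat /= cats0 size_cat sW size_map.
- apply: schedule_rcons => // g /mapP[h /Hl Sh ->]; exists h => //.
  exact: aff_trans Sh.
- move=> f [/HS|[h hl ->]].
    apply: affS => g [Vg|/= gl]; [by left|right].
    by rewrite /= -cats1 flatten_cat mem_cat gl.
  apply: aff_gen; right; rewrite /= -cats1 flatten_cat mem_cat /= cats0.
  by apply/orP; right; apply/mapP; exists h.
Qed.

Lemma computes_parallel V L W1 W2 S1 S2 : computes V L W1 S1 -> computes V L W2 S2 ->
  computes V L (W1 + W2) (S1 `|` S2).
Proof.
move=> [ls [sL sW Hls HS]] [ms [tL tW Hms HS2]].
have sz : size ls = size ms by rewrite sL tL.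
have mem f : f \in flatten (parallel ls ms) = (f \in flatten ls) || (f \in flatten ms).
  by rewrite (perm_mem (perm_parallel sz)) mem_cat.
exists (parallel ls ms); split.
- by rewrite size_parallel.
- by rewrite (perm_size (perm_parallel sz)) size_cat sW tW.
- exact: schedule_parallel.
- by move=> f [/HS|/HS2]; apply: affS => g [Vg|/= gl];
    [left|right; rewrite /= mem gl|left|right; rewrite /= mem gl orbT].
Qed.

Lemma computes_family V L W N (S : nat -> set fn) :
  (forall i, (i < N)%N -> computes V L W (S i)) ->
  computes V L (N * W) [set f | exists2 i, (i < N)%N & S i f].
Proof.
elim: N => [|N IH] HS.
  exists (nseq L [::]); split; first by rewrite size_nseq.
  - by rewrite mul0n; elim: (L).
  - by elim: (L) (V) => //= m IH U; split => //; exact: IH.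
  - by move=> f [].
rewrite mulSnr.
have h1 := IH (fun i iN => HS i (leqW iN)).
apply: computes_aff (computes_parallel h1 (HS N (leqnn _))) _ => f [j].
rewrite ltnS leq_eqVlt => /orP[/eqP->|jN] Sf; apply: aff_gen; first by right.
by left; exists j.
Qed.

End Schedules.

Section Realization.
Variable R : realType.

Definition zero_tuple n : n.-tuple R := [tuple 0 | i < n].

(** The affine functions of the vector of available values [phi]. *)
Definition affine_in (T : Type) n (phi : T -> n.-tuple R) : set (T -> R) :=
  [set f | exists w : n.-tuple R, exists b, forall x, f x = dotp w (phi x) + b].

Lemma affine_in_aff (T : Type) n (phi : T -> n.-tuple R) (V : set (T -> R)) :
  V `<=` affine_in phi -> aff V `<=` affine_in phi.
Proof.
move=> HV f; elim => {f} [f /HV//|b|f g _ [w [b Hf]] _ [v [c Hg]]|a f _ [w [b Hf]]].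
- exists (zero_tuple n), b => x; rewrite /dotp big1 ?add0r// => i _.
  by rewrite tnth_mktuple mul0r.
- exists [tuple tnth w i + tnth v i | i < n], (b + c) => x.
  rewrite Hf Hg /dotp addrACA -big_split /=; congr (_ + _); apply: eq_bigr => i _.
  by rewrite tnth_mktuple mulrDl.
- exists [tuple a * tnth w i | i < n], (a * b) => x.
  rewrite Hf /dotp mulrDr mulr_sumr; congr (_ + _); apply: eq_bigr => i _.
  by rewrite tnth_mktuple mulrA.
Qed.

Lemma dotp_cat n k (w z : n.-tuple R) (v y : k.-tuple R) :
  dotp [tuple of w ++ v] [tuple of z ++ y] = dotp w z + dotp v y.
Proof.
rewrite /dotp big_split_ord /=; congr (_ + _); apply: eq_bigr => i _.
  by rewrite !tnth_lshift.
by rewrite !tnth_rshift.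
Qed.

Lemma dotp0 n (z : n.-tuple R) : dotp (zero_tuple n) z = 0.
Proof. by rewrite /dotp big1 // => i _; rewrite tnth_mktuple mul0r. Qed.

Lemma dotp_delta n (z : n.-tuple R) (i : 'I_n) :
  dotp [tuple (j == i)%:R | j < n] z = tnth z i.
Proof.
rewrite /dotp (bigD1 i)//= tnth_mktuple eqxx mul1r big1 ?addr0// => j ji.
by rewrite tnth_mktuple (negbTE ji) mul0r.
Qed.

(** A schedule is turned into a network by induction on its layers; [phi] is the
vector of values available before the first of them. *)
Lemma schedule_realized (T : Type) (ls : seq (seq (T -> R))) :
  forall n (phi : T -> n.-tuple R) V f, V `<=` affine_in phi -> schedule V ls ->
  aff (V `|` [set` flatten ls]) f ->
  exists N : relu_net R n, [/\ forall x, relu_eval N (phi x) = f x,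
    relu_depth N = size ls & relu_size N = size (flatten ls)].
Proof.
elim: ls => [|l ls IH] n phi V f HV /=.
  move=> _ Vf; have : affine_in phi f.
    by apply: affine_in_aff Vf => g [/HV|].
  by move=> [w [b Hf]]; exists (Output w b); split => //= x; rewrite Hf.
move=> [Hl Hls] Vf.
have /choice[u Hu] (g : T -> R) : exists u : n.-tuple R * R, g \in l ->
    forall x, g x = relu (dotp u.1 (phi x) + u.2).
  have [gl|_] := boolP (g \in l); last by exists (zero_tuple n, 0).
  have [h Vh gE] := Hl g gl; have [w [b Hh]] := affine_in_aff HV Vh.
  by exists (w, b) => _ x; rewrite gE Hh.
pose U : (size l).-tuple (n.-tuple R * R) := [tuple of map u (in_tuple l)].
pose act x : (size l).-tuple R := [tuple of map (fun u => relu (dotp u.1 (phi x) + u.2)) U].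
pose phi' x : (n + size l).-tuple R := [tuple of phi x ++ act x].
have HV' : V `|` [set` l] `<=` affine_in phi'.
  move=> g [/HV [w [b Hg]]|/= gl].
    exists [tuple of w ++ zero_tuple (size l)], b => x.
    by rewrite dotp_cat dotp0 addr0.
  have il : (index g l < size l)%N by rewrite index_mem.
  exists [tuple of zero_tuple n ++ [tuple (j == Ordinal il)%:R | j < size l]], 0 => x.
  rewrite dotp_cat dotp0 add0r addr0 dotp_delta !tnth_map (Hu g gl).
  by rewrite (tnth_nth g) /= nth_index.
have Vf' : aff ((V `|` [set` l]) `|` [set` flatten ls]) f.
  apply: affS Vf => g [Vg|/=]; first by left; left.
  by rewrite mem_cat => /orP[gl|gl]; [left; right|right].
have [N [N1 N2 N3]] := IH _ phi' _ _ HV' Hls Vf'.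
exists (Hidden U N); split => [x||] /=; first exact: N1.
  by rewrite N2.
by rewrite N3 size_cat.
Qed.

(** The input functions of a network. *)
Definition coordinates n : set (n.-tuple R -> R) :=
  [set f | exists i : 'I_n, f = fun x => tnth x i].

Lemma computes_realized n L W (S : set (n.-tuple R -> R)) f :
  computes (@coordinates n) L W S -> aff S f ->
  exists N : relu_net R n, [/\ forall x, relu_eval N x = f x,
    relu_depth N = L & relu_size N = W].
Proof.
move=> [ls [<- <- Hls HS]] Sf.
apply: (@schedule_realized _ _ _ id) Hls _; last exact: aff_trans Sf.
move=> g [i ->]; exists [tuple (j == i)%:R | j < n], 0 => x.
by rewrite addr0 dotp_delta.
Qed.

End Realization.

(** * Networks for products, powers and the kernel *)

Section Multiplication.
Variable R : realType.
Implicit Types (x y v p : R) (n k : nat).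

Lemma relu_pos x : 0 <= x -> relu x = x.
Proof. by move=> x0; rewrite /relu; apply/max_idPr. Qed.

Lemma relu_neg x : x <= 0 -> relu x = 0.
Proof. by move=> x0; rewrite /relu; apply/max_idPl. Qed.

(** The tooth function of [[0, 1]], equal to [2 * x] up to [1/2] and to
[2 - 2 * x] beyond; outside [[0, 1]] its values are irrelevant. *)
Definition tooth x : R := 2 * x - 4 * relu (x - 2^-1).

Lemma tooth_itv x : 0 <= x <= 1 -> 0 <= tooth x <= 1.
Proof.
rewrite /tooth => /andP[x0 x1]; have [h|h] := leP x 2^-1.
  by rewrite relu_neg; [apply/andP; split; lra|lra].
by rewrite relu_pos; [apply/andP; split; lra|lra].
Qed.

Lemma tooth_logistic x : x * (1 - x) = (tooth x + tooth x * (1 - tooth x)) / 4.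
Proof.
rewrite /tooth; have [h|h] := leP x 2^-1.
  by rewrite relu_neg; [field|lra].
by rewrite relu_pos; [field|lra].
Qed.

(** Piecewise linear approximation of [x * (1 - x)] on [[0, 1]]. *)
Definition saw n x : R := \sum_(i < n) iter i.+1 tooth x / 4 ^+ i.+1.

Lemma sawS n x : saw n.+1 x = (tooth x + saw n (tooth x)) / 4.
Proof.
rewrite /saw big_ord_recl /= expr1 [RHS]mulrDl; congr (_ + _).
rewrite mulr_suml; apply: eq_bigr => i _.
by rewrite /bump leq0n add1n -iterSr /= [in LHS]exprSr invfM mulrA.
Qed.

Lemma saw_approx n x : 0 <= x <= 1 ->
  0 <= x * (1 - x) - saw n x <= 4^-1 ^+ n.
Proof.
elim: n x => [|n IH] x x01.
  rewrite /saw big_ord0 subr0 expr0; move: x01 => /andP[x0 x1].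
  by apply/andP; split; nra.
have /IH/andP[h1 h2] := tooth_itv x01.
rewrite sawS tooth_logistic exprS; apply/andP; split; lra.
Qed.

(** Approximate product of [v] and [p] in [[0, 1]]. *)
Definition mult n v p : R :=
  (v + p) / 2 - 4^-1 - saw n ((v + p) / 2) + saw n ((1 + v - p) / 2).

Lemma mult_approx n v p : 0 <= v <= 1 -> 0 <= p <= 1 ->
  `|mult n v p - v * p| <= 4^-1 ^+ n.
Proof.
move=> /andP[v0 v1] /andP[p0 p1].
have h1 : 0 <= (v + p) / 2 <= 1 by apply/andP; split; lra.
have h2 : 0 <= (1 + v - p) / 2 <= 1 by apply/andP; split; lra.
have /andP[a1 a2] := saw_approx n h1; have /andP[b1 b2] := saw_approx n h2.
have e : v * p = (v + p) / 2 - 4^-1 - (v + p) / 2 * (1 - (v + p) / 2) +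
  (1 + v - p) / 2 * (1 - (1 + v - p) / 2) by field.
rewrite e /mult ler_norml; apply/andP; split; lra.
Qed.

(** Projection of the real line onto [[0, 1]]. *)
Definition clamp01 y : R := relu y - relu (y - 1).

Lemma clamp01_itv y : 0 <= clamp01 y <= 1.
Proof.
rewrite /clamp01; have [h|h] := leP y 0.
  by rewrite !relu_neg; [apply/andP; split; lra|lra|lra].
rewrite (relu_pos (ltW h)); have [h'|h'] := leP y 1.
  by rewrite relu_neg; [apply/andP; split; lra|lra].
by rewrite relu_pos; [apply/andP; split; lra|lra].
Qed.

Lemma clamp01_le0 y : y <= 0 -> clamp01 y = 0.
Proof. by move=> h; rewrite /clamp01 !relu_neg ?subrr//; lra. Qed.

Lemma clamp01_ge1 y : 1 <= y -> clamp01 y = 1.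
Proof. by move=> h; rewrite /clamp01 !relu_pos; lra. Qed.

Lemma clamp01_id y : 0 <= y <= 1 -> clamp01 y = y.
Proof.
by move=> /andP[h1 h2]; rewrite /clamp01 relu_pos// relu_neg ?subr0//; lra.
Qed.

Lemma clamp01_dist y z : 0 <= z <= 1 -> `|clamp01 y - z| <= `|y - z|.
Proof.
move=> /andP[z0 z1]; have [h|h] := leP y 0.
  by rewrite clamp01_le0// !ler0_norm; lra.
have [h'|h'] := leP y 1; first by rewrite clamp01_id// (ltW h).
by rewrite clamp01_ge1 ?ger0_norm; lra.
Qed.

(** Approximation of [v ^+ k]; clamping keeps the factors within the range where
[mult] is accurate. *)
Fixpoint approx_pow n v k : R :=
  if k is k'.+1 then clamp01 (mult n v (approx_pow n v k')) else 1.

Lemma approx_pow_itv n v k : 0 <= approx_pow n v k <= 1.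
Proof. by case: k => [|k]; rewrite /= ?ler01 ?lexx//; exact: clamp01_itv. Qed.

Lemma approx_powP n v k : 0 <= v <= 1 ->
  `|approx_pow n v k - v ^+ k| <= k%:R * 4^-1 ^+ n.
Proof.
move=> v01; have /andP[v0 v1] := v01.
elim: k => [|k IH] /=; first by rewrite expr0 subrr normr0 mul0r.
set q := approx_pow n v k in IH *.
have q01 : 0 <= q <= 1 by exact: approx_pow_itv.
apply: le_trans (clamp01_dist _ _) _.
  by rewrite exprn_ge0//= exprn_ile1.
rewrite (_ : _ - _ = (mult n v q - v * q) + v * (q - v ^+ k)); last first.
  by rewrite exprS; ring.
rewrite (le_trans (ler_normD _ _))// -natr1 mulrDl mul1r addrC lerD ?mult_approx//.
rewrite normrM (ger0_norm v0) (le_trans _ IH)// ler_piMl//.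
Qed.

Section Networks.
Variable T : Type.
Implicit Types (V S : set (T -> R)).

Lemma computes_clamp01 V L W S f : computes V L W S -> aff S f ->
  computes V L.+1 (W + 2) (S `|` [set fun t => clamp01 (f t)]).
Proof.
move=> HS Sf; pose l := [:: f; fun t => f t - 1].
have Hl g : g \in l -> aff S g.
  rewrite !inE => /orP[|] /eqP -> //; apply: aff_sub => //; exact: aff_cst.
apply: computes_aff (computes_layer HS Hl) _ => g [Sg|->].
  by apply: aff_gen; left.
apply: aff_sub; apply: aff_gen; right.
  by exists f => //; rewrite mem_head.
by exists (fun t => f t - 1) => //; rewrite in_cons mem_head orbT.
Qed.

(** Each layer produces the next iterate of the tooth function at both [u] and
[w]: one unit for each, the linear part of [tooth] being free. *)
Lemma computes_teeth V L W S u w n : computes V L W S -> aff S u -> aff S w ->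
  computes V (L + n) (W + n * 2)
    (S `|` [set g | exists2 j, (j <= n)%N &
      g = (fun t => iter j tooth (u t)) \/ g = (fun t => iter j tooth (w t))]).
Proof.
move=> HS Su Sw; elim: n => [|n IH].
  rewrite addn0 mul0n addn0; apply: computes_aff HS _ => g [Sg|[j]].
    exact: aff_gen.
  by rewrite leqn0 => /eqP -> /= [->|->].
set S' := _ `|` _ in IH.
pose l := [:: (fun t => iter n tooth (u t) - 2^-1); (fun t => iter n tooth (w t) - 2^-1)].
have Hl g : g \in l -> aff S' g.
  rewrite !inE => /orP[|] /eqP ->; apply: aff_sub; try exact: aff_cst;
    apply: aff_gen; right; exists n => //; [by left|by right].
rewrite addnS mulSnr addnA.
apply: computes_aff (computes_layer IH Hl) _ => g [Sg|[j]].
  by apply: aff_gen; left; left.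
rewrite leq_eqVlt ltnS => /orP[/eqP-> Hg|jn Hg]; last first.
  by apply: aff_gen; left; right; exists j.
case: Hg => -> /=; apply: aff_sub; apply: aff_scale; apply: aff_gen.
- by left; right; exists n => //; left.
- by right; exists (fun t => iter n tooth (u t) - 2^-1) => //; rewrite mem_head.
- by left; right; exists n => //; right.
- by right; exists (fun t => iter n tooth (w t) - 2^-1) => //; rewrite in_cons mem_head orbT.
Qed.

Lemma computes_mult V L W S (v p : T -> R) n : computes V L W S -> aff S v -> aff S p ->
  computes V (L + n.+1) (W + (n * 2 + 2)) (S `|` [set fun t => clamp01 (mult n (v t) (p t))]).
Proof.
move=> HS Sv Sp.
pose u t := (v t + p t) / 2; pose w t := (1 + v t - p t) / 2.
have Su : aff S u.
  rewrite (_ : u = fun t => 2^-1 * (v t + p t)).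
    by apply: aff_scale; exact: aff_add.
  by apply/funext => t; rewrite mulrC.
have Sw : aff S w.
  rewrite (_ : w = fun t => 2^-1 * (1 + v t - p t)).
    by apply: aff_scale; apply: aff_sub => //; apply: aff_add => //; exact: aff_cst.
  by apply/funext => t; rewrite mulrC.
have := computes_teeth n HS Su Sw; set S' := _ `|` _ => HS'.
have SS' : S `<=` aff S' by move=> g Sg; apply: aff_gen; left.
have saw_in f : (forall j, (j <= n)%N -> aff S' (fun t => iter j tooth (f t))) ->
    aff S' (fun t => saw n (f t)).
  move=> Hf; apply: (@aff_sum_ord _ _ _ n (fun i t => iter i.+1 tooth (f t) / 4 ^+ i.+1)).
  move=> j jn; rewrite (_ : (fun t => _) = fun t => (4 ^+ j.+1)^-1 * iter j.+1 tooth (f t)).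
    by apply: aff_scale; exact: Hf.
  by apply/funext => t; rewrite mulrC.
have Sm : aff S' (fun t => mult n (v t) (p t)).
  apply: aff_add; [apply: aff_sub; [apply: aff_sub|]|].
  - exact: aff_trans Su.
  - exact: aff_cst.
  - by apply: (saw_in u) => j jn; apply: aff_gen; right; exists j => //; left.
  - by apply: (saw_in w) => j jn; apply: aff_gen; right; exists j => //; right.
rewrite addnS addnA; apply: computes_aff (computes_clamp01 HS' Sm) _.
by move=> g [Sg|->]; apply: aff_gen; [left; left|right].
Qed.

Lemma computes_powers V L W S (v : T -> R) n k : computes V L W S -> aff S v ->
  computes V (L + k * n.+1) (W + k * (n * 2 + 2))
    (S `|` [set g | exists2 j, (j <= k)%N & g = fun t => approx_pow n (v t) j]).
Proof.
move=> HS Sv; elim: k => [|k IH].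
  rewrite !mul0n !addn0; apply: computes_aff HS _ => g [Sg|[j]]; first exact: aff_gen.
  by rewrite leqn0 => /eqP -> -> /=; exact: aff_cst.
set S' := _ `|` _ in IH.
have Sv' : aff S' v by apply: affS Sv => g; left.
have Sp' : aff S' (fun t => approx_pow n (v t) k).
  by apply: aff_gen; right; exists k.
rewrite (mulSnr k n.+1) (mulSnr k (n * 2 + 2)) (addnA L) (addnA W).
apply: computes_aff (computes_mult n IH Sv' Sp') _ => g [Sg|[j]]; first by apply: aff_gen; left; left.
rewrite leq_eqVlt ltnS => /orP[/eqP-> ->|jk ->]; apply: aff_gen; first by right.
by left; right; exists j.
Qed.

Lemma computes_polynomial V (v : T -> R) n (c : nat -> R) : aff V v ->
  computes V (1 + n * n.+1) (2 + n * (n * 2 + 2))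
    [set fun t => \sum_(k < n) c k * approx_pow n (clamp01 (v t)) k].
Proof.
move=> Vv; have H0 := computes_clamp01 (computes_input V) Vv.
have Vc : aff (V `|` [set fun t => clamp01 (v t)]) (fun t => clamp01 (v t)).
  by apply: aff_gen; right.
apply: computes_aff (computes_powers n n H0 Vc) _ => g ->.
apply: (@aff_sum_ord _ _ _ n (fun k t => c k * approx_pow n (clamp01 (v t)) k)) => k kn.
by apply: aff_scale; apply: aff_gen; right; exists k => //; exact: ltnW.
Qed.

End Networks.

Lemma weighted_geometric_sum n : \sum_(k < n) k%:R * 2^-1 ^+ k <= 2 :> R.
Proof.
suff -> : \sum_(k < n) k%:R * 2^-1 ^+ k = 2 - 2 * (n.+1)%:R * 2^-1 ^+ n :> R.
  by rewrite lerBlDr lerDl mulr_ge0// exprn_ge0// invr_ge0.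
elim: n => [|n IH]; first by rewrite big_ord0 expr0; ring.
rewrite big_ord_recr /= IH exprS -[n.+2%:R]natr1 -[n.+1%:R]natr1.
by move: (2^-1 ^+ n) => p; field.
Qed.

(** Only the term of the piece that contains [y] depends on [y]; the other ones
are values of [f] at the integers. *)
Lemma telescoping_clamps (f : R -> R) (J : nat) y : 0 <= y <= J.+1%:R ->
  \sum_(j < J.+1) f (j%:R + clamp01 (y - j%:R)) = f y + \sum_(j < J) f j.+1%:R.
Proof.
elim: J => [|J IH] /andP[y0 yJ].
  by rewrite big_ord1 big_ord0 addr0 subr0 add0r clamp01_id// y0.
rewrite big_ord_recr /=; have [h|h] := leP y J.+1%:R.
  rewrite IH ?y0// clamp01_le0 ?addr0; last by rewrite subr_le0.
  by rewrite [in RHS]big_ord_recr /= addrA.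
rewrite clamp01_id; last by rewrite -natr1 in yJ; apply/andP; split; lra.
rewrite addrC (addrC _ (y - _)) subrK; congr (_ + _); apply: eq_bigr => j _.
rewrite clamp01_ge1 ?natr1//.
have : (j.+1%:R : R) <= J.+1%:R by rewrite ler_nat.
rewrite -natr1; lra.
Qed.

End Multiplication.

Section KernelNetwork.
Variable R : realType.

Lemma ReB (x y : R[i]) : complex.Re (x - y) = complex.Re x - complex.Re y.
Proof. by case: x; case: y. Qed.

Lemma Re_sum (I : Type) (r : seq I) (P : pred I) (F : I -> R[i]) :
  complex.Re (\sum_(i <- r | P i) F i) = \sum_(i <- r | P i) complex.Re (F i).
Proof. by apply: (big_morph (@complex.Re R)) => // -[? ?] [? ?]. Qed.

Lemma Re_scale (x : R[i]) (t : R) : complex.Re (x * t%:C) = complex.Re x * t.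
Proof. by case: x => a b /=; rewrite mulr0 subr0. Qed.

(** Networks for [Re (zeta * K t)] on [[- A, A]], with an error exponentially small
in [n], of depth and size quadratic in [n]. *)
Lemma kernel_network (s : R) : 1 < s -> exists2 J : nat, (0 < J)%N &
  forall (A C : R) (K : R -> R[i]), 0 < A -> continuable_to (ellipse A s) C K ->
  forall (n : nat) (zeta : R[i]), cmod zeta <= 1 ->
  exists2 phi : R -> R,
    forall t, `|t| <= A -> `|phi t - complex.Re (zeta * K t)| <= 3 * J%:R * C * 2^-1 ^+ n &
    forall (T : Type) (V : set (T -> R)) t, aff V t ->
      computes V (1 + n * n.+1) (J * (2 + n * (n * 2 + 2))) [set fun x => phi (t x)].
Proof.
move=> s1; have [J J0 HJ] := kernel_taylor_pieces s1; exists J => //.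
move=> A C K A0 HK n zeta z1.
have [c Hc] := HJ A C K A0 HK n.
have JR : 0 < (J%:R : R) by rewrite ltr0n.
pose h := 2 * A / J%:R; have h0 : 0 < h by rewrite divr_gt0// mulr_gt0.
pose y t := (t + A) / h.
pose kap x := complex.Re (zeta * K (- A + h * x)).
pose piece j t := \sum_(k < n) complex.Re (zeta * c j k) *
  approx_pow n (clamp01 (y t - j%:R)) k.
pose phi t := \sum_(j < J) piece j t - \sum_(j < J.-1) kap j.+1%:R.
exists phi; last first.
  move=> T V t Vt.
  have Vy j : aff V (fun x => y (t x) - j%:R).
    apply: aff_sub; last exact: aff_cst.
    rewrite (_ : (fun x => _) = fun x => h^-1 * (t x + A)).
      by apply: aff_scale; apply: aff_add => //; exact: aff_cst.
    by apply/funext => x; rewrite mulrC.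
  have := computes_family (fun j (_ : (j < J)%N) =>
    computes_polynomial n (fun k => complex.Re (zeta * c j k)) (Vy j)).
  move=> H; apply: computes_aff H _ => g ->.
  apply: aff_sub; last exact: aff_cst.
  apply: (@aff_sum_ord _ _ _ J (fun j x => piece j (t x))) => j jJ.
  by apply: aff_gen; exists j.
move=> t tA.
have yJ : 0 <= y t <= J%:R.
  move: tA; rewrite ler_norml => /andP[t1 t2].
  apply/andP; split; first by apply: divr_ge0; [lra|exact: ltW].
  by rewrite ler_pdivrMr// /h mulrC divfK ?gt_eqF//; lra.
have Ky : K t = K (- A + h * y t).
  by congr K; rewrite /y mulrC divfK ?gt_eqF//; ring.
rewrite (_ : phi t - _ =
    \sum_(j < J) (piece j t - kap (j%:R + clamp01 (y t - j%:R)))); last first.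
  rewrite sumrB /phi Ky -/(kap (y t)).
  have : \sum_(j < J) kap (j%:R + clamp01 (y t - j%:R)) =
      kap (y t) + \sum_(j < J.-1) kap j.+1%:R.
    by case: (J) J0 yJ => // J' _ yJ; exact: telescoping_clamps.
  by move=> ->; ring.
have C0 : 0 <= C.
  by rewrite (le_trans (cmod_ge0 _) (continuable_bound s1 A0 HK tA)).
apply: le_trans (ler_norm_sum _ _ _) _.
apply: (@le_trans _ _ (\sum_(j < J) (3 * C * 2^-1 ^+ n))); last first.
  by rewrite sumr_const card_ord -mulr_natl le_eqVlt; apply/orP; left; apply/eqP; ring.
apply: ler_sum => j _.
have [Hc1 Hc2] := Hc j (ltn_ord j).
set v := clamp01 _; have v01 : 0 <= v <= 1 by exact: clamp01_itv.
have {Hc2} := Hc2 v v01; rewrite -/h => Hc2.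
have e1 : piece j t - kap (j%:R + v) =
  \sum_(k < n) complex.Re (zeta * c j k) * (approx_pow n v k - v ^+ k)
  - complex.Re (zeta * (K (- A + h * (j%:R + v)) - \sum_(k < n) c j k * v%:C ^+ k)).
  have -> : piece j t = \sum_(k < n) complex.Re (zeta * c j k) * approx_pow n v k by [].
  rewrite mulrBr ReB mulr_sumr Re_sum opprB -/(kap _) [RHS]addrA; congr (_ - _).
  rewrite -big_split /=; apply: eq_bigr => k _.
  by rewrite mulrA -rmorphXn Re_scale; ring.
have zle z : `|complex.Re (zeta * z)| <= cmod z.
  by rewrite (le_trans (Re_le_cmod _))// cmodM ler_piMl ?cmod_ge0.
have e2 : `|\sum_(k < n) complex.Re (zeta * c j k) * (approx_pow n v k - v ^+ k)|
    <= 2 * C * 4^-1 ^+ n.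
  apply: le_trans (ler_norm_sum _ _ _) _.
  apply: (@le_trans _ _ (C * 4^-1 ^+ n * \sum_(k < n) k%:R * 2^-1 ^+ k)); last first.
    rewrite (mulrC 2) -!mulrA ler_wpM2l// mulrC ler_wpM2r ?exprn_ge0 ?invr_ge0//.
    exact: weighted_geometric_sum.
  rewrite mulr_sumr; apply: ler_sum => k _; rewrite normrM.
  apply: le_trans (ler_pM _ _ (zle _) (approx_powP n k v01)) _ => //.
  have : 0 <= k%:R * 4^-1 ^+ n :> R by rewrite mulr_ge0// exprn_ge0.
  move=> h1; have := ler_wpM2r h1 (Hc1 k (ltn_ord k)).
  move=> /le_trans; apply; rewrite le_eqVlt; apply/orP; left; apply/eqP; ring.
have e3 : (4^-1 : R) ^+ n <= 2^-1 ^+ n by rewrite lerXn2r ?nnegrE//; lra.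
rewrite e1 (le_trans (ler_normB _ _))//.
have := le_trans (zle _) Hc2 => e4.
have : 2 * C * 4^-1 ^+ n <= 2 * C * 2^-1 ^+ n by rewrite ler_wpM2l// mulr_ge0.
lra.
Qed.

End KernelNetwork.

(** * Sampling an average in L2 *)

Section BoundedMeasurable.
Context d (X : measurableType d) (R : realType).
Variable m : {finite_measure set X -> \bar R}.
Implicit Types f g : X -> R.

(** Bounded measurable functions; they form an algebra and are integrable for
finite measures. *)
Definition bounded_meas f : Prop :=
  measurable_fun [set: X] f /\ exists M : R, forall x, `|f x| <= M.

Lemma bounded_meas_cst (c : R) : bounded_meas (fun=> c).
Proof. by split; [exact: measurable_cst|exists `|c|]. Qed.

Lemma bounded_measD f g : bounded_meas f -> bounded_meas g ->
  bounded_meas (fun x => f x + g x).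
Proof.
move=> [mf [M HM]] [mg [N HN]]; split; first exact: measurable_funD.
by exists (M + N) => x; rewrite (le_trans (ler_normD _ _))// lerD.
Qed.

Lemma bounded_measM f g : bounded_meas f -> bounded_meas g ->
  bounded_meas (fun x => f x * g x).
Proof.
move=> [mf [M HM]] [mg [N HN]]; split; first exact: measurable_funM.
by exists (M * N) => x; rewrite normrM ler_pM.
Qed.

Lemma bounded_measB f g : bounded_meas f -> bounded_meas g ->
  bounded_meas (fun x => f x - g x).
Proof.
move=> [mf [M HM]] [mg [N HN]]; split; first exact: measurable_funB.
by exists (M + N) => x; rewrite (le_trans (ler_normB _ _))// lerD.
Qed.

Lemma bounded_meas_sum (n : nat) (F : nat -> X -> R) :
  (forall i, (i < n)%N -> bounded_meas (F i)) -> bounded_meas (fun x => \sum_(i < n) F i x).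
Proof.
elim: n => [|n IH] HF.
  rewrite (_ : (fun x => _) = fun=> 0); first exact: bounded_meas_cst.
  by apply/funext => x; rewrite big_ord0.
rewrite (_ : (fun x => _) = fun x => \sum_(i < n) F i x + F n x).
  by apply: bounded_measD; [apply: IH => i ni; apply: HF; exact: leqW|exact: HF].
by apply/funext => x; rewrite big_ord_recr.
Qed.

Lemma bounded_meas_integrable f : bounded_meas f -> m.-integrable setT (EFin \o f).
Proof.
move=> [mf [M HM]]; apply: measurable_bounded_integrable => //.
  exact: fin_num_fun_lty.
by exists M; split; [exact: num_real|move=> N /ltW MN x _ /=; exact: le_trans MN].
Qed.

End BoundedMeasurable.

Section Sampling.
Context dX dY (X : measurableType dX) (Y : measurableType dY) (R : realType).
Variables (m : {finite_measure set X -> \bar R}) (nu : {sigma_finite_measure set Y -> \bar R}).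
Variables (G : Y * X -> R) (rho : Y -> R).
Hypothesis mG : measurable_fun [set: Y * X] G.
Hypothesis irho : nu.-integrable setT (EFin \o rho).
Hypothesis Grho : forall w x, `|G (w, x)| <= rho w.

Let mX : R := fine (m setT).
Let C : R := \int[nu]_w rho w.
Let f x : R := \int[nu]_w G (w, x).

Let rho0 w : 0 <= rho w.
Proof. by apply: le_trans (Grho w point); exact: normr_ge0. Qed.

Let mXE : m setT = mX%:E.
Proof. by rewrite fineK// fin_num_measure. Qed.

Let C0 : 0 <= C. Proof. by apply: Rintegral_ge0. Qed.

Lemma dominated_product_integrable (P : Y * X -> R) (M : R) :
  measurable_fun setT P -> (forall w x, `|P (w, x)| <= M * rho w) ->
  (nu \x m)%E.-integrable setT (EFin \o P).
Proof.
move=> mP HP; apply/integrable12ltyP; first exact/measurable_EFinP.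
have mabs : measurable_fun setT (fun z => `|(P z)%:E|%E).
  by apply: measurableT_comp => //; exact/measurable_EFinP.
have mF : measurable_fun setT (fun w => \int[m]_x `|(P (w, x))%:E|)%E.
  exact: (@measurable_fun_fubini_tonelli_F _ _ _ _ _ m (fun z => `|(P z)%:E|%E)).
have i2 : nu.-integrable setT (fun w => (M * mX)%:E * (rho w)%:E)%E.
  exact: integrableZl.
apply: le_lt_trans (integrable_lty measurableT i2).
apply: ge0_le_integral => //.
- by move=> w _; exact: integral_ge0.
- exact: measurable_int i2.
move=> w _ /=.
apply: (@le_trans _ _ (\int[m]_x (M * rho w)%:E))%E.
  apply: ge0_le_integral => //.
  - exact: (measurable_fun_pair2 _ mabs).
  - by move=> x _; rewrite lee_fin.
rewrite integral_cst//; have := mXE; rewrite /= => ->.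
by rewrite -EFinM lee_fin mulrAC.
Qed.

Let iG : (nu \x m)%E.-integrable setT (EFin \o G).
Proof. by apply: (@dominated_product_integrable G 1) => // w x; rewrite mul1r. Qed.

Lemma section_integrable x : nu.-integrable setT (EFin \o (fun w => G (w, x))).
Proof.
apply: le_integrable irho => //.
  by apply/measurable_EFinP; exact: measurable_fun_pair1.
by move=> w _ /=; rewrite lee_fin (ger0_norm (rho0 w)).
Qed.

(** [f] is the average of the sections of [G]; it inherits their domination. *)
Lemma average_le x : `|f x| <= C.
Proof.
rewrite (le_trans (le_normr_Rintegral _ (section_integrable x)))//.
apply: le_Rintegral => //.
exact: (integrable_norm (section_integrable x)).
Qed.

Lemma average_bounded_meas : bounded_meas f.
Proof.
split; last by exists C; exact: average_le.
have -> : f = fine \o fubini_G nu (EFin \o G) by [].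
apply: measurableT_comp; first exact: fine_measurable.
exact: (measurable_fubini_G iG).
Qed.

Let G_bounded w : bounded_meas (fun x => G (w, x)).
Proof. by split; [exact: measurable_fun_pair2|exists (rho w) => x; exact: Grho]. Qed.

Let g w x := C * G (w, x) / rho w.

Let g_bounded w : bounded_meas (g w).
Proof.
rewrite (_ : g w = fun x => C / rho w * G (w, x)).
  by apply: bounded_measM => //; exact: bounded_meas_cst.
by apply/funext => x; rewrite /g mulrAC.
Qed.

(** Fubini's theorem for the product of [G] with a bounded function of [x]. *)
Lemma exchange_integrals H : bounded_meas H ->
  nu.-integrable setT (fun w => (\int[m]_x (H x * G (w, x)))%:E) /\
  \int[nu]_w (\int[m]_x (H x * G (w, x))) = \int[m]_x (H x * f x).
Proof.
move=> Hb; have [mH [M HM]] := Hb.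
pose P (z : Y * X) := H z.2 * G z.
have mP : measurable_fun setT P.
  by apply: measurable_funM => //; exact: measurableT_comp.
have iP : (nu \x m)%E.-integrable setT (EFin \o P).
  apply: (@dominated_product_integrable P M) => // w x.
  by rewrite normrM ler_pM.
have E1 w : (\int[m]_x (H x * G (w, x)))%:E = fubini_F m (EFin \o P) w.
  rewrite fineK//; apply: integrable_fin_num => //.
  exact: bounded_meas_integrable (bounded_measM Hb (G_bounded w)).
have E2 x : (H x * f x)%:E = fubini_G nu (EFin \o P) x.
  rewrite /fubini_G /= -(RintegralZl _ measurableT (section_integrable x)) fineK//.
  apply: integrable_fin_num => //.
  exact: (integrableZl measurableT (H x) (section_integrable x)).
split.
  rewrite (_ : (fun w => _) = fubini_F m (EFin \o P)); first exact: integrable_fubini_F.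
  exact/funext.
rewrite {1}/Rintegral [in RHS]/Rintegral; congr fine.
under eq_integral do rewrite E1.
under [RHS]eq_integral do rewrite E2.
exact: Fubini.
Qed.

(** The normalized samples [g w] average to [f] for the probability density
[rho / C]; hence any linear functional takes at some [w] at most its average
value, up to [dl]. *)
Lemma good_sample H (dl : R) : 0 < C -> 0 < dl -> bounded_meas H ->
  exists2 w, 0 < rho w &
    \int[m]_x (H x * g w x) <= \int[m]_x (H x * f x) + dl.
Proof.
move=> C_gt0 dl0 Hb; apply/not_exists2P => Hno.
pose I := \int[m]_x (H x * f x); pose Phi w := \int[m]_x (H x * G (w, x)).
have [iPhi EPhi] := exchange_integrals Hb.
have le w : (I + dl) * rho w <= C * Phi w.
  have [r0|] := eqVneq (rho w) 0.
    rewrite r0 mulr0 /Phi.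
    have G0 x : G (w, x) = 0 by apply/eqP; rewrite -normr_le0 -r0 Grho.
    under eq_Rintegral do rewrite G0 mulr0.
    by rewrite Rintegral_cst// mul0r mulr0.
  rewrite neq_lt ltNge rho0 /= => r0; case: (Hno w) => [|/negP].
    by rewrite r0.
  rewrite -ltNge => /ltW; rewrite -/I.
  rewrite (_ : \int[m]_x _ = C / rho w * Phi w).
    by rewrite mulrAC ler_pdivlMr.
  rewrite /Phi -RintegralZl//.
    by apply: eq_Rintegral => x _; rewrite /g; ring.
  exact: bounded_meas_integrable (bounded_measM Hb (G_bounded w)).
have : \int[nu]_w ((I + dl) * rho w) <= \int[nu]_w (C * Phi w).
  apply: le_Rintegral => //.
    exact: (integrableZl measurableT (I + dl) irho).
  exact: (integrableZl measurableT C iPhi).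
rewrite !RintegralZl// -/C EPhi -/I mulrC ler_pM2l// ; lra.
Qed.

(** Adding one well chosen error term increases the squared norm by little more
than [C ^+ 2 * mX]. *)
Lemma sampling_step S (dl : R) : 0 < C -> 0 < dl -> bounded_meas S ->
  exists2 w, 0 < rho w &
    \int[m]_x (S x + (g w x - f x)) ^+ 2 <= \int[m]_x (S x ^+ 2) + (C ^+ 2 * mX + dl).
Proof.
move=> C_gt0 dl0 Sb; have fb := average_bounded_meas.
have Hb := bounded_measB Sb fb.
have dl2 : 0 < dl / 2 by rewrite divr_gt0.
have [w w0 Hw] := good_sample C_gt0 dl2 Hb; exists w => //.
have gC x : g w x ^+ 2 <= C ^+ 2.
  rewrite -real_normK ?num_real// lerXn2r ?nnegrE//.
  rewrite /g normrM normfV normrM (gtr0_norm w0) (gtr0_norm C_gt0).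
  by rewrite ler_pdivrMr// ler_pM2l.
have gb := g_bounded w.
have b1 := bounded_measM Hb gb; have b2 := bounded_measM Hb fb.
have b3 : bounded_meas (fun x => S x ^+ 2).
  by under eq_fun do rewrite expr2; exact: bounded_measM.
have b4 := bounded_measM (bounded_meas_cst X (2 : R)) (bounded_measB b1 b2).
have b5 := bounded_measD b3 b4.
have b6 := bounded_measD b5 (bounded_meas_cst X (C ^+ 2)).
(* [(S + (g - f)) ^+ 2 = S ^+ 2 + 2 * ((S - f) * g - (S - f) * f) + g ^+ 2 - f ^+ 2]. *)
apply: (@le_trans _ _ (\int[m]_x (S x ^+ 2 + 2 * ((S x - f x) * g w x - (S x - f x) * f x) + C ^+ 2))).
  apply: le_Rintegral => //; try exact: bounded_meas_integrable.
    apply: bounded_meas_integrable; under eq_fun do rewrite expr2.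
    by apply: bounded_measM; apply: bounded_measD => //; apply: bounded_measB.
  by move=> x _; have := gC x; have := sqr_ge0 (f x); nra.
have i1 := bounded_meas_integrable m b1; have i2 := bounded_meas_integrable m b2.
have i3 := bounded_meas_integrable m b3; have i4 := bounded_meas_integrable m b4.
have i5 := bounded_meas_integrable m b5.
have i12 := bounded_meas_integrable m (bounded_measB b1 b2).
have ic := bounded_meas_integrable m (bounded_meas_cst X (C ^+ 2)).
rewrite (RintegralD _ i5 ic)// (RintegralD _ i3 i4)// (RintegralZl 2 _ i12)//.
rewrite (RintegralB _ i1 i2)// Rintegral_cst// -/mX.
lra.
Qed.

Lemma sampling (dl : R) n : 0 < C -> 0 < dl -> exists w : nat -> Y,
  (forall i, (i < n)%N -> 0 < rho (w i)) /\
  \int[m]_x (\sum_(i < n) (g (w i) x - f x)) ^+ 2 <= n%:R * (C ^+ 2 * mX + dl).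
Proof.
move=> C_gt0 dl0; elim: n => [|n [w [w0 Hw]]].
  exists (fun=> point); split => //.
  under eq_Rintegral do rewrite big_ord0 expr0n /=.
  by rewrite Rintegral_cst// !mul0r.
have fb := average_bounded_meas.
have Sb : bounded_meas (fun x => \sum_(i < n) (g (w i) x - f x)).
  apply: (@bounded_meas_sum _ _ _ n (fun i x => g (w i) x - f x)) => i _.
  exact: bounded_measB.
have [v v0 Hv] := sampling_step C_gt0 dl0 Sb.
exists (fun i => if (i < n)%N then w i else v); split.
  by move=> i _; case: ifP => // /w0.
under eq_Rintegral => x _.
  rewrite big_ord_recr /= ltnn.
  rewrite (eq_bigr (fun i : 'I_n => g (w i) x - f x)); last by move=> i _; rewrite ltn_ord.
  over.
rewrite -natr1 mulrDl mul1r; apply: le_trans Hv _.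
by rewrite lerD2r.
Qed.

(** A deterministic form of Maurey's lemma: some mean of [n.+1] normalized samples
is close to the average in [L^2]. *)
Lemma sampling_mean n : 0 < C -> 0 < mX -> exists w : nat -> Y,
  (forall i, (i < n.+1)%N -> 0 < rho (w i)) /\
  \int[m]_x (\sum_(i < n.+1) C / n.+1%:R / rho (w i) * G (w i, x) - f x) ^+ 2
    <= 2 * (C ^+ 2 * mX) / n.+1%:R.
Proof.
move=> C_gt0 mX_gt0.
have dl0 : 0 < C ^+ 2 * mX by rewrite mulr_gt0// exprn_gt0.
have [w [w0 Hw]] := sampling n.+1 C_gt0 dl0; exists w; split => //.
have n0 : 0 < (n.+1%:R : R) by rewrite ltr0n.
have E x : \sum_(i < n.+1) C / n.+1%:R / rho (w i) * G (w i, x) - f x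
    = n.+1%:R^-1 * \sum_(i < n.+1) (g (w i) x - f x).
  rewrite sumrB sumr_const card_ord mulrBr -[f x *+ _]mulr_natl mulKf ?gt_eqF//; congr (_ - _).
  by rewrite mulr_sumr; apply: eq_bigr => i _; rewrite /g; ring.
under eq_Rintegral do rewrite E exprMn.
rewrite RintegralZl//; last first.
  have := bounded_meas_sum (n := n.+1) (F := fun i x => g (w i) x - f x) (fun i _ =>
     bounded_measB (g_bounded (w i)) average_bounded_meas) => b.
  by under eq_fun do rewrite expr2; apply: bounded_meas_integrable; exact: bounded_measM.
rewrite exprVn ler_pdivrMl ?exprn_gt0//; apply: le_trans Hw _.
rewrite le_eqVlt; apply/orP; left; apply/eqP; field.
by rewrite gt_eqF.
Qed.

End Sampling.

(** * Measurability and integrability on tuples *)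

Section MeasurabilityOnTuples.
Variable R : realType.

Lemma measurable_cube n (a b : R) : measurable (@cube R n a b).
Proof.
have -> : @cube R n a b =
    \bigcap_(i in [set: 'I_n]) ((fun x : n.-tuple R => tnth x i) @^-1` `[a, b]%classic).
  apply/seteqP; split => x Hx i; first by move=> _ /=; rewrite in_itv; exact: Hx.
  by have := Hx i I; rewrite /= in_itv.
apply: fin_bigcap_measurable; first exact: finite_finset.
move=> i _; rewrite -[X in measurable X]setTI; exact: measurable_tnth.
Qed.

Lemma lebesgue_cube_lty n (a b : R) :
  (lebesgue_tuple R n (cube a b) < +oo)%E.
Proof.
elim: n => [|n IH]; first by rewrite /= diracE; case: (_ \in _); rewrite ltry.
change (lebesgue_cons (lebesgue_tuple R n) (cube a b) < +oo)%E.
rewrite /lebesgue_cons /pushforward.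
rewrite (_ : _ @^-1` _ = `[a, b]%classic `*` cube a b).
  rewrite product_measure1E//; last exact: measurable_cube.
  have ab : (lebesgue_measure (`[a, b]%classic : set R) < +oo)%E.
    by rewrite lebesgue_measure_itv /=; case: ifP; rewrite -?EFinB ltry.
  by apply: lte_mul_pinfty => //; rewrite ge0_fin_numE.
apply/seteqP; split => [[x t] /= H|[x t] /= [+ H]].
  split; first by have := H ord0; rewrite /= in_itv /= tnth0.
  by move=> i; have := H (lift ord0 i); rewrite tnthS.
rewrite in_itv /= => xab i.
by case: (unliftP ord0 i) => [j|] ->; rewrite ?tnthS ?tnth0//; exact: H.
Qed.

Lemma measurable_dotp d (T : measurableType d) n (f g : T -> n.-tuple R) :
  measurable_fun setT f -> measurable_fun setT g ->
  measurable_fun setT (fun x => dotp (f x) (g x)).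
Proof.
move=> mf mg; apply: measurable_sum => i; apply: measurable_funM.
  by apply: (measurableT_comp (measurable_tnth i) mf).
by apply: (measurableT_comp (measurable_tnth i) mg).
Qed.

Lemma measurable_relu_eval n (N : relu_net R n) : measurable_fun setT (relu_eval N).
Proof.
elim: N => {n} [n w b|n k U N IH] /=.
  apply: measurable_funD => //; apply: measurable_dotp => //.
apply: measurableT_comp IH _; apply/measurable_fun_tnthP => i.
rewrite -(splitK i); case: (fintype.split i) => j /=.
  rewrite (_ : _ \o _ = fun x => tnth x j); first exact: measurable_tnth.
  by apply/funext => x /=; rewrite tnth_lshift.
rewrite (_ : _ \o _ = fun x => relu (dotp (tnth U j).1 x + (tnth U j).2)).
  apply: measurable_maxr => //; apply: measurable_funD => //.
  exact: measurable_dotp.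
by apply/funext => x /=; rewrite tnth_rshift tnth_map.
Qed.

Lemma cmod_sqrt (z : R[i]) :
  cmod z = Num.sqrt (complex.Re z ^+ 2 + complex.Im z ^+ 2).
Proof. by case: z. Qed.

Lemma measurable_cmod d (T : measurableType d) (D : set T) (g : T -> R[i]) :
  measurable_fun D (fun x => complex.Re (g x)) ->
  measurable_fun D (fun x => complex.Im (g x)) ->
  measurable_fun D (fun x => cmod (g x)).
Proof.
move=> mr mi; under eq_fun do rewrite cmod_sqrt.
apply: (@measurableT_comp _ _ _ _ _ _ (@Num.sqrt R)).
  by apply: continuous_measurable_fun; exact: sqrt_continuous.
by apply: measurable_funD; exact: measurable_funX.
Qed.

Lemma inL2_integrable d (T : measurableType d) (nu : {measure set T -> \bar R})
    (D : set T) (g : T -> R[i]) : measurable D -> (nu D < +oo)%E -> inL2 nu D g ->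
  nu.-integrable D (EFin \o (fun x => cmod (g x))).
Proof.
move=> mD Doo [mr mi goo].
have mc := measurable_cmod mr mi.
have i2 : nu.-integrable D (EFin \o (fun x => cmod (g x) ^+ 2)).
  apply/integrableP; split; first by apply/measurable_EFinP; exact: measurable_funX.
  rewrite ltNge leye_eq; apply/negP => /eqP E; move: goo.
  rewrite /l2norm (_ : (\int[nu]_(x in D) _)%E = +oo%E); first by rewrite ltxx.
  rewrite -E; apply: eq_integral => x _ /=.
  by rewrite ger0_norm// exprn_ge0// cmod_ge0.
have i1 : nu.-integrable D (EFin \o (fun=> 1 : R)).
  apply: measurable_bounded_integrable => //.
  by exists 1; split; [exact: num_real|move=> N /ltW MN x _ /=; rewrite normr1].
have := integrableD mD i1 i2; apply: le_integrable => //.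
  exact/measurable_EFinP.
move=> x _ /=; rewrite lee_fin; have := cmod_ge0 (g x) => c0.
rewrite !ger0_norm ?addr_ge0 ?exprn_ge0//; nra.
Qed.

End MeasurabilityOnTuples.

(** * Bandlimited functions as averages *)

Section RidgeIntegral.
Variables (R : realType) (d : nat) (M : R) (K : R -> R[i]) (F : d.-tuple R -> R[i]).
Let A : R := d%:R * M.
Hypothesis M0 : 0 <= M.
Hypothesis Kcont : forall t : R, `|t| <= A -> forall e : R, 0 < e ->
  exists2 dl : R, 0 < dl &
    forall t' : R, `|t'| <= A -> `|t' - t| < dl -> cmod (K t' - K t) < e.
Hypothesis FL2 : inL2 (lebesgue_tuple R d) (cube (- M) M) F.

Let A0 : 0 <= A. Proof. by rewrite mulr_ge0. Qed.

(** Projection of the real line onto [[- B, B]]. *)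
Definition trunc_to (B t : R) : R := Num.max (- B) (Num.min B t).

Lemma trunc_to_le B t : 0 <= B -> `|trunc_to B t| <= B.
Proof.
move=> B0; rewrite /trunc_to ler_norml le_max lexx /= ge_max ge_min lexx /=.
by rewrite andbT; lra.
Qed.

Lemma trunc_to_id B t : `|t| <= B -> trunc_to B t = t.
Proof.
rewrite ler_norml => /andP[t1 t2]; rewrite /trunc_to.
by rewrite (min_idPr _)// (max_idPr _).
Qed.

Lemma trunc_to_lip B t t' : `|trunc_to B t' - trunc_to B t| <= `|t' - t|.
Proof.
have absP (x y : R) : x <= `|x - y| + y /\ y <= `|x - y| + x.
  by have := ler_norm (x - y); have := ler_norm (y - x); rewrite (distrC y); lra.
have maxP (a x y : R) : `|Num.max a x - Num.max a y| <= `|x - y|.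
  have [? ?] := absP x y; have ? := normr_ge0 (x - y).
  rewrite ler_norml; apply/andP; split;
    have [?|?] := leP a x; have [?|?] := leP a y; lra.
have minP (a x y : R) : `|Num.min a x - Num.min a y| <= `|x - y|.
  have [? ?] := absP x y; have ? := normr_ge0 (x - y).
  rewrite ler_norml; apply/andP; split;
    have [?|?] := leP a x; have [?|?] := leP a y; lra.
exact: le_trans (maxP _ _ _) (minP _ _ _).
Qed.

Lemma trunc_to_continuous (k : R[i] -> R) :
  (forall a b, `|k a - k b| <= cmod (a - b)) ->
  continuous (fun t => k (K (trunc_to A t))).
Proof.
move=> kl t; apply/cvgrPdist_lt => e e0.
have [dl dl0 Hdl] := Kcont (trunc_to_le t A0) e0.
apply: filterS (nbhsx_ballx t dl dl0) => t' /= tt'.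
rewrite distrC; apply: le_lt_trans (kl _ _) _; apply: Hdl; first exact: trunc_to_le.
by apply: le_lt_trans (trunc_to_lip _ _ _) _; rewrite distrC.
Qed.

Let KR t := complex.Re (K (trunc_to A t)).
Let KI t := complex.Im (K (trunc_to A t)).

Let mKR : measurable_fun setT KR.
Proof.
apply: continuous_measurable_fun; apply: trunc_to_continuous => a b.
by rewrite -ReB Re_le_cmod.
Qed.

Let mKI : measurable_fun setT KI.
Proof.
apply: continuous_measurable_fun; apply: trunc_to_continuous => a b.
by rewrite (_ : _ - _ = complex.Im (a - b)) ?Im_le_cmod//; case: a; case: b.
Qed.

Let W : set (d.-tuple R) := cube (- M) M.
Let mW : measurable W. Proof. exact: measurable_cube. Qed.

(** The integrand [Re (F w * K (w . x))], extended by [0] to the frequencies [w]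
outside the cube, and to all [x] by truncating the argument of [K] to
[[- d * M, d * M]], so that it is measurable and bounded in [x]. *)
Definition kernel_section (z : d.-tuple R * d.-tuple R) : R :=
  ((fun w => complex.Re (F w)) \_ (@cube R d (- M) M)) z.1 * KR (dotp z.1 z.2) -
  ((fun w => complex.Im (F w)) \_ (@cube R d (- M) M)) z.1 * KI (dotp z.1 z.2).

(** The modulus of [F], extended by [0] outside the cube. *)
Definition density : d.-tuple R -> R := (fun w => cmod (F w)) \_ (@cube R d (- M) M).

Lemma measurable_kernel_section : measurable_fun setT kernel_section.
Proof.
have [mr mi _] := FL2.
have mdot : measurable_fun setT (fun z : d.-tuple R * d.-tuple R => dotp z.1 z.2).
  exact: measurable_dotp.
have mFR := (measurable_restrictT _ mW).1 mr.
have mFI := (measurable_restrictT _ mW).1 mi.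
apply: measurable_funB; apply: measurable_funM.
- exact: (measurableT_comp mFR measurable_fst).
- exact: (measurableT_comp mKR mdot).
- exact: (measurableT_comp mFI measurable_fst).
- exact: (measurableT_comp mKI mdot).
Qed.

Lemma density_integrable : (lebesgue_tuple R d).-integrable setT (EFin \o density).
Proof.
have := inL2_integrable mW (lebesgue_cube_lty _ _ _) FL2.
by rewrite integrable_mkcond// restrict_EFin.
Qed.

Lemma kernel_sectionE w x : W w ->
  kernel_section (w, x) = complex.Re (F w * K (trunc_to A (dotp w x))).
Proof.
move=> Ww; rewrite /kernel_section /= !patchE mem_set//.
by rewrite /KR /KI; case: (F w) => a b; case: (K _).
Qed.

Lemma kernel_section_le (b : R) w x : (forall t : R, `|t| <= A -> cmod (K t) <= b) ->
  `|kernel_section (w, x)| <= b * density w.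
Proof.
move=> Kb.
have [Ww|Ww] := pselect (W w).
  rewrite kernel_sectionE// /density patchE mem_set//.
  rewrite (le_trans (Re_le_cmod _))// cmodM mulrC ler_wpM2r ?cmod_ge0//.
  exact/Kb/trunc_to_le.
by rewrite /kernel_section /density /= !patchE memNset// !mul0r subrr normr0 mulr0.
Qed.

Lemma dotp_cube_le w x : W w -> cube 0 1 x -> `|dotp w x| <= A.
Proof.
move=> Ww Bx; rewrite /dotp (le_trans (ler_norm_sum _ _ _))//.
apply: (@le_trans _ _ (\sum_(i < d) M)); last first.
  by rewrite sumr_const card_ord -mulr_natl.
apply: ler_sum => i _; rewrite normrM.
have /andP[x0 x1] := Bx i; have := Ww i; rewrite -ler_norml => wM.
by rewrite (ger0_norm x0) (le_trans _ wM)// ler_piMr.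
Qed.

Lemma bandlimited_average (f : d.-tuple R -> R) x :
  represents K M (cube 0 1) (fun x => (f x)%:C) F -> cube 0 1 x ->
  f x = \int[lebesgue_tuple R d]_w kernel_section (w, x).
Proof.
move=> [_ Hf] Bx; have /(congr1 (@complex.Re R)) /= -> := Hf x Bx.
rewrite Rintegral_mkcond; apply: eq_Rintegral => w _; rewrite patchE.
case: ifPn => [/set_mem Ww|/negP nW].
  by rewrite kernel_sectionE// trunc_to_id//; exact: dotp_cube_le.
rewrite /kernel_section /= !patchE memNset ?mul0r ?subrr//.
by move=> Ww; apply: nW; exact: mem_set.
Qed.

Lemma density_integral :
  \int[lebesgue_tuple R d]_w density w =
  \int[lebesgue_tuple R d]_(w in cube (- M) M) cmod (F w).
Proof. by rewrite [RHS]Rintegral_mkcond. Qed.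

End RidgeIntegral.

Section L2Distance.
Variables (R : realType) (d : nat) (mu : {measure set (d.-tuple R) -> \bar R}).
Variable B : set (d.-tuple R).
Hypothesis mB : measurable B.
Hypothesis Boo : (mu B < +oo)%E.
Let m : {finite_measure set (d.-tuple R) -> \bar R} := mfrestr mB Boo.

(** Only the values on [B] matter: [f] need not be measurable outside [B], where it
coincides with the measurable function [fbar]. *)
Lemma L2_distance_le (net f fbar P : d.-tuple R -> R) (eps : R) : 0 <= eps ->
  measurable_fun setT net -> measurable_fun setT fbar -> {in B, f =1 fbar} ->
  bounded_meas P -> (forall x, 0 <= P x) ->
  (forall x, B x -> (net x - f x) ^+ 2 <= P x) ->
  \int[m]_x P x <= eps ^+ 2 ->
  (sqrte (\int[mu]_(x in B) (`|net x - f x| ^+ 2)%:E) <= eps%:E)%E.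
Proof.
move=> eps0 mnet mfbar ff Pb P0 HP Hint.
rewrite -[leRHS]gee0_abs ?lee_fin// -sqrte_sqr lee_sqrt ?sqre_ge0//.
rewrite (_ : (\int[mu]_(x in B) _ = \int[m]_(x in B) ((net x - fbar x) ^+ 2)%:E)%E); last first.
  transitivity (\int[mu]_(x in B) ((net x - fbar x) ^+ 2)%:E)%E.
    by apply: eq_integral => x xB; rewrite real_normK ?num_real// (ff x xB).
  apply: eq_measure_integral => X mX XB /=.
  by rewrite /mfrestr /mrestr setIidl.
have iP := bounded_meas_integrable m Pb.
have mnf : measurable_fun setT (fun x => ((net x - fbar x) ^+ 2)%:E).
  by apply/measurable_EFinP; apply: measurable_funX; exact: measurable_funB.
have mP : measurable_fun setT (fun x => (P x)%:E).
  by apply/measurable_EFinP; case: Pb.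
apply: (@le_trans _ _ (\int[m]_(x in B) (P x)%:E)%E).
  apply: ge0_le_integral => //.
  - by move=> x _; rewrite lee_fin sqr_ge0.
  - exact: measurable_funTS.
  - exact: measurable_funTS.
  - by move=> x Bx; rewrite lee_fin -(ff x (mem_set Bx)) HP.
apply: (@le_trans _ _ (\int[m]_x (P x)%:E)%E).
  by apply: ge0_subset_integral => // x _; rewrite lee_fin.
rewrite -EFin_expe -lee_fin in Hint *; apply: le_trans Hint.
by rewrite /Rintegral fineK//; exact: integrable_fin_num.
Qed.

End L2Distance.

(** * The two kinds of networks *)

Section NetworkApproximation.
Variables (R : realType) (s : R) (d : nat) (M C_K : R) (K : R -> R[i]).
Variables (f : d.-tuple R -> R) (F : d.-tuple R -> R[i]).
Variables (mu : {measure set (d.-tuple R) -> \bar R}) (eps : R).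
Let A : R := d%:R * M.
Hypothesis s_gt1 : 1 < s.
Hypothesis A_gt0 : 0 < A.
Hypothesis M_ge0 : 0 <= M.
Hypothesis Kext : continuable_to (ellipse A s) C_K K.
Hypothesis rep : represents K M (cube 0 1) (fun x => (f x)%:C) F.
Hypothesis muB_lty : (mu (cube 0 1) < +oo)%E.
Hypothesis eps_ge0 : 0 <= eps.

Let C_F := \int[lebesgue_tuple R d]_(w in cube (- M) M) cmod (F w).
Let muB := fine (mu (cube 0 1)).
Let mB : measurable (@cube R d 0 1). Proof. exact: measurable_cube. Qed.
Let m : {finite_measure set (d.-tuple R) -> \bar R} := mfrestr mB muB_lty.
Let FL2 : inL2 (lebesgue_tuple R d) (cube (- M) M) F. Proof. by case: rep. Qed.
Let Kcont := continuable_continuous s_gt1 A_gt0 Kext.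
Let mG := measurable_kernel_section M_ge0 Kcont FL2.
Let irho := density_integrable FL2.
Let fbar x := \int[lebesgue_tuple R d]_w kernel_section M K F (w, x).

Let ffbar : {in cube 0 1, f =1 fbar}.
Proof. by move=> x /set_mem; exact: bandlimited_average. Qed.

Let m_total : fine (m setT) = muB.
Proof. by rewrite /m /= /mfrestr /mrestr setTI. Qed.

Let muB0 : 0 <= muB. Proof. by rewrite fine_ge0. Qed.

(** A uniform bound [b] on [K] yields [|f| <= b * C_F] on the cube. *)
Lemma zero_network_error (b : R) : (forall t : R, `|t| <= A -> cmod (K t) <= b) ->
  b * C_F * Num.sqrt muB <= eps ->
  (sqrte (\int[mu]_(x in cube 0 1) (`|0 - f x| ^+ 2)%:E) <= eps%:E)%E.
Proof.
move=> Kb small.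
have b0 : 0 <= b by apply: le_trans (cmod_ge0 _) (Kb 0 _); rewrite normr0 ltW.
have Gb w x : `|kernel_section M K F (w, x)| <= b * density M F w.
  exact: kernel_section_le.
have ibrho : (lebesgue_tuple R d).-integrable setT (EFin \o (fun w => b * density M F w)).
  exact: (integrableZl measurableT b irho).
have fb : forall x, `|fbar x| <= b * C_F.
  move=> x; have := average_le mG ibrho Gb x.
  by rewrite RintegralZl// density_integral.
have [mfbar _] := average_bounded_meas m mG ibrho Gb.
have CF0 : 0 <= C_F by apply: Rintegral_ge0 => w _; exact: cmod_ge0.
apply: (@L2_distance_le _ _ _ _ mB muB_lty (fun=> 0) f fbar (fun=> (b * C_F) ^+ 2)) => //.
- exact: bounded_meas_cst.
- by move=> x; rewrite sqr_ge0.
- move=> x Bx; rewrite sub0r sqrrN (ffbar (mem_set Bx)) -real_normK ?num_real//.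
  by rewrite lerXn2r ?nnegrE ?mulr_ge0.
rewrite Rintegral_cst// m_total -[muB in leLHS]sqr_sqrtr// -exprMn.
by rewrite lerXn2r ?nnegrE ?mulr_ge0 ?sqrtr_ge0.
Qed.

(** The network that averages kernel networks over [N.+1] sampled frequencies.
The two inequalities on [N] and [n] make the sampling error and the error on
the kernel at most [eps / 2] each. *)
Lemma sampled_network (J : nat)
  (HJ : forall (A C : R) (K : R -> R[i]), 0 < A -> continuable_to (ellipse A s) C K ->
    forall (n : nat) (zeta : R[i]), cmod zeta <= 1 -> exists2 phi : R -> R,
    forall t, `|t| <= A -> `|phi t - complex.Re (zeta * K t)| <= 3 * J%:R * C * 2^-1 ^+ n &
    forall (T : Type) (V : set (T -> R)) t, aff V t ->
      computes V (1 + n * n.+1) (J * (2 + n * (n * 2 + 2))) [set fun x => phi (t x)])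
  (n N : nat) :
  (forall t : R, `|t| <= A -> cmod (K t) <= 1) ->
  0 < C_F -> 0 < muB ->
  8 * (C_F ^+ 2 * muB) <= N.+1%:R * eps ^+ 2 ->
  6 * J%:R * C_K * C_F * Num.sqrt muB <= eps * 2 ^+ n ->
  exists net : relu_net R d,
    [/\ relu_depth net = (1 + n * n.+1)%N,
        relu_size net = (N.+1 * (J * (2 + n * (n * 2 + 2))))%N &
        (sqrte (\int[mu]_(x in cube 0 1) (`|relu_eval net x - f x| ^+ 2)%:E) <= eps%:E)%E].
Proof.
move=> K1 CF_gt0 muB_gt0 HN Hn.
pose rho := density M F; pose G := kernel_section M K F.
have Grho w x : `|G (w, x)| <= rho w.
  have : `|G (w, x)| <= 1 * density M F w by exact: kernel_section_le.
  by rewrite mul1r.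
have CE : \int[lebesgue_tuple R d]_w rho w = C_F by exact: density_integral.
have [w [w0 Hw]] := sampling_mean (m := m) mG irho Grho N
  (eq_ind_r (fun c => 0 < c) CF_gt0 CE) (eq_ind_r (fun c => 0 < c) muB_gt0 m_total).
rewrite m_total CE in Hw.
have wW i : (i < N.+1)%N -> cube (- M) M (w i).
  move=> /w0; rewrite /rho /density patchE; case: ifPn => [/set_mem//|_].
  by rewrite ltxx.
have rhoE i : (i < N.+1)%N -> rho (w i) = cmod (F (w i)).
  by move=> iN; rewrite /rho /density patchE mem_set//; exact: wW.
have /choice[phi Hphi] i : exists phi : R -> R, (i < N.+1)%N ->
    (forall t, `|t| <= A -> `|phi t - complex.Re (F (w i) / (rho (w i))%:C * K t)|
        <= 3 * J%:R * C_K * 2^-1 ^+ n) /\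
    forall (T : Type) (V : set (T -> R)) t, aff V t ->
      computes V (1 + n * n.+1) (J * (2 + n * (n * 2 + 2))) [set fun x => phi (t x)].
  have [iN|_] := boolP (i < N.+1)%N; last by exists (fun=> 0).
  have [|p p1 p2] := HJ A C_K K A_gt0 Kext n (F (w i) / (rho (w i))%:C).
    rewrite cmodM cmodV cmod_real gtr0_norm ?w0//.
    by rewrite rhoE// divff// gt_eqF// -rhoE// w0.
  by exists p.
set dl := 3 * J%:R * C_K * 2^-1 ^+ n in Hphi.
pose net x := \sum_(i < N.+1) C_F / N.+1%:R * phi i (dotp (w i) x).
have aff_dotp i : aff (@coordinates R d) (dotp (w i)).
  apply: (@aff_sum _ _ _ _ _ (fun j x => tnth (w i) j * tnth x j)) => j.
  by apply: aff_scale; apply: aff_gen; exists j.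
have comp i (iN : (i < N.+1)%N) := (Hphi i iN).2 _ _ _ (aff_dotp i).
have aff_net : aff [set g | exists2 i, (i < N.+1)%N &
    [set fun x => phi i (dotp (w i) x)] g] net.
  apply: (@aff_sum_ord _ _ _ N.+1 (fun i x => C_F / N.+1%:R * phi i (dotp (w i) x))).
  by move=> i iN; apply: aff_scale; apply: aff_gen; exists i.
have [nn [evalE depthE sizeE]] := computes_realized (computes_family comp) aff_net.
exists nn; split => //.
have N0 : 0 < (N.+1%:R : R) by rewrite ltr0n.
have dl0 : 0 <= dl.
  by apply: le_trans (normr_ge0 _) ((Hphi 0%N (ltn0Sn _)).1 0 _); rewrite normr0 ltW.
pose fn x := \sum_(i < N.+1) C_F / N.+1%:R / rho (w i) * G (w i, x).
have net_fn x : cube 0 1 x -> `|net x - fn x| <= C_F * dl.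
  move=> Bx; rewrite -sumrB (le_trans (ler_norm_sum _ _ _))//.
  apply: (@le_trans _ _ (\sum_(i < N.+1) C_F / N.+1%:R * dl)); last first.
    rewrite sumr_const card_ord -mulr_natr le_eqVlt; apply/orP; left; apply/eqP.
    by field; rewrite gt_eqF.
  apply: ler_sum => i _; have iN := ltn_ord i.
  have tA := dotp_cube_le (wW i iN) Bx.
  have -> : C_F / N.+1%:R / rho (w i) * G (w i, x) =
     C_F / N.+1%:R * complex.Re (F (w i) / (rho (w i))%:C * K (dotp (w i) x)).
    rewrite /G (kernel_sectionE _ _ _ (wW i iN)) trunc_to_id//.
    rewrite (mulrAC (F _)) -[(_%:C)^-1]fmorphV Re_scale; ring.
  have c0 : 0 <= C_F / N.+1%:R by apply: divr_ge0; exact: ltW.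
  by rewrite -mulrBr normrM (ger0_norm c0) ler_wpM2l//; exact: (Hphi i iN).1.
have fbar_b := average_bounded_meas m mG irho Grho.
have fn_b : bounded_meas fn.
  apply: (@bounded_meas_sum _ _ _ N.+1 (fun i x => C_F / N.+1%:R / rho (w i) * G (w i, x))).
  move=> i _; apply: bounded_measM; first exact: bounded_meas_cst.
  split; first exact: (measurable_fun_pair2 _ mG).
  by exists (rho (w i)) => x; exact: Grho.
have sq_b : bounded_meas (fun x => (fn x - fbar x) ^+ 2).
  under eq_fun do rewrite expr2.
  by apply: bounded_measM; exact: bounded_measB.
have sq2_b := bounded_measM (bounded_meas_cst (d.-tuple R) (2 : R)) sq_b.
have cst_b := bounded_meas_cst (d.-tuple R) (2 * (C_F * dl) ^+ 2).
apply: (@L2_distance_le _ _ _ _ mB muB_lty (relu_eval nn) f fbar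
  (fun x => 2 * (fn x - fbar x) ^+ 2 + 2 * (C_F * dl) ^+ 2)) => //.
- exact: measurable_relu_eval.
- by case: fbar_b.
- exact: bounded_measD.
- by move=> x; rewrite addr_ge0// mulr_ge0// sqr_ge0.
- move=> x Bx; rewrite evalE (ffbar (mem_set Bx)).
  have h1 : (net x - fn x) ^+ 2 <= (C_F * dl) ^+ 2.
    have c0 : 0 <= C_F * dl by apply: mulr_ge0 => //; exact: ltW.
    rewrite -(real_normK (num_real (net x - fn x))) lerXn2r ?nnegrE//.
    exact: net_fn.
  have := sqr_ge0 ((net x - fn x) - (fn x - fbar x)); nra.
rewrite (RintegralD _ (bounded_meas_integrable m sq2_b) (bounded_meas_integrable m cst_b))//.
rewrite (RintegralZl _ _ (bounded_meas_integrable m sq_b))// Rintegral_cst// m_total.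
have h1 : 2 * \int[m]_x (fn x - fbar x) ^+ 2 <= eps ^+ 2 / 2.
  have : 2 * (C_F ^+ 2 * muB) / N.+1%:R <= eps ^+ 2 / 4 by rewrite ler_pdivrMr//; lra.
  by have := Hw; rewrite -/G -/rho => hw h; have := le_trans hw h; lra.
have h2 : (C_F * dl) ^+ 2 * muB <= eps ^+ 2 / 4.
  have e4 : eps ^+ 2 / 4 = (eps / 2) ^+ 2 by field.
  have p2 : 0 < 2 ^+ n :> R by rewrite exprn_gt0.
  have q0 : 0 <= C_F * dl * Num.sqrt muB.
    by apply: mulr_ge0 => //; apply: mulr_ge0 => //; exact: ltW.
  rewrite e4 -[muB in leLHS]sqr_sqrtr// -exprMn.
  apply: lerXn2r; rewrite ?nnegrE//; first by rewrite divr_ge0.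
  rewrite -(ler_pM2r p2) /dl exprVn.
  have -> : C_F * (3 * J%:R * C_K * (2 ^+ n)^-1) * Num.sqrt muB * 2 ^+ n
    = 3 * J%:R * C_K * C_F * Num.sqrt muB by field; rewrite gt_eqF.
  lra.
lra.
Qed.

End NetworkApproximation.

(** * The choice of the degree and of the sample size *)

(** Some power of [2] above [a * x] has an exponent at most proportional to
[log2_1 x]; that exponent bounds the degree of the polynomials. *)
Lemma degree_choice (R : realType) (a : R) : 1 <= a ->
  exists2 kap : R, 1 <= kap & forall x : R, 0 < x ->
    exists n : nat, a * x <= 2 ^+ n /\ n%:R <= kap * log2_1 x.
Proof.
move=> a1; have a0 : 0 < a by lra.
have ln2 : 0 < ln 2 :> R by apply: ln_gt0; lra.
have la : 0 <= log2 a by apply: divr_ge0; [exact: ln_ge0|exact: ltW].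
exists (log2 a + 2); first lra.
move=> x x0; exists (Num.truncn (log2 (a * x))).+1.
have ax0 : 0 < a * x by rewrite mulr_gt0.
have l1 : 1 <= log2_1 x by rewrite le_max lexx.
have lx : log2 x <= log2_1 x by rewrite le_max lexx orbT.
have lax : log2 (a * x) = log2 a + log2 x by rewrite /log2 lnM ?posrE// mulrDl.
split.
  rewrite -ler_ln ?posrE ?exprn_gt0// lnXn//.
  have : log2 (a * x) <= (Num.truncn (log2 (a * x))).+1%:R.
    by apply/ltW/real_truncnS_gt; exact: num_real.
  by rewrite {1}/log2 ler_pdivrMr// mulr_natl.
have [y0|y0] := leP 0 (log2 (a * x)).
  rewrite -natr1; have : (Num.truncn (log2 (a * x)))%:R <= log2 (a * x) by rewrite truncn_le.
  rewrite lax; nra.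
have -> : Num.truncn (log2 (a * x)) = 0%N.
  by apply/eqP; rewrite -leqn0 leqNgt truncn_gt_nat -ltNge; lra.
nra.
Qed.

Theorem theorem3p3 (R : realType) (s : R) (s_gt1 : 1 < s) :
  exists c : R, 0 < c /\
  forall (d : nat) (M C_K D_K : R) (K : R -> R[i]),
    (2 <= d)%N -> 1 <= M -> 0 < C_K -> 0 < D_K <= 1 ->
    real_analytic K ->
    (forall t : R, - (d%:R * M) <= t <= d%:R * M -> cmod (K t) <= D_K) ->
    continuable_to (ellipse (d%:R * M) s) C_K K ->
  forall (f : d.-tuple R -> R) (F : d.-tuple R -> R[i]),
    bandlimited K M (cube 0 1) (fun x => (f x)%:C) ->
    minimal_representer K M (cube 0 1) (fun x => (f x)%:C) F ->
  forall (mu : {measure set (d.-tuple R) -> \bar R}) (eps : R),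
    (mu (cube 0 1) < +oo)%E -> 0 < eps < 1 ->
    let C_F := \int[lebesgue_tuple R d]_(w in cube (- M) M) cmod (F w) in
    let muB := fine (mu (cube 0 1)) in
    let l := log2_1 (C_F * C_K * Num.sqrt muB / eps) in
  exists N : relu_net R d,
    [/\ (relu_depth N)%:R <= c * (1 / log2 s ^+ 2 * l ^+ 2),
        (relu_size N)%:R
          <= c * (C_F ^+ 2 * muB / (eps ^+ 2 * log2 s ^+ 2) * l ^+ 2) &
        (sqrte (\int[mu]_(x in cube 0 1) (`|relu_eval N x - f x| ^+ 2)%:E)
           <= eps%:E)%E].
Proof.
have [J J0 HJ] := kernel_network s_gt1.
have J1 : 1 <= J%:R :> R by rewrite ler1n.
have J6 : 1 <= 6 * J%:R :> R by lra.
have [kap kap1 Hkap] := degree_choice J6.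
have ls0 : 0 < log2 s by apply: divr_gt0; apply: ln_gt0; lra.
(* [54 = 9 * 6], from [N.+1 <= 9 * rho ^+ 2] and, for [n <= y] with [1 <= y],
   [2 + n * (n * 2 + 2) <= 6 * y ^+ 2]. *)
have c0 : 0 < 54 * J%:R * kap ^+ 2 * log2 s ^+ 2.
  by apply: mulr_gt0; rewrite ?exprn_gt0// mulr_gt0 ?exprn_gt0//; lra.
exists (54 * J%:R * kap ^+ 2 * log2 s ^+ 2); split=> //.
move=> d M C_K D_K K d2 M1 CK0 /andP[_ DK1] _ Kbd Kext f F _ [rep _] mu eps muB_lty.
move=> /andP[eps0 _] C_F muB l.
have A_gt0 : 0 < d%:R * M by apply: mulr_gt0; [rewrite ltr0n; exact: ltn_trans d2|lra].
have M_ge0 : 0 <= M by lra.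
have K1 t : `|t| <= d%:R * M -> cmod (K t) <= 1.
  by rewrite ler_norml => /Kbd /le_trans; apply.
have KC t : `|t| <= d%:R * M -> cmod (K t) <= C_K.
  exact: (continuable_bound s_gt1 A_gt0 Kext).
have CF0 : 0 <= C_F by apply: Rintegral_ge0 => w _; exact: cmod_ge0.
have mu0 : 0 <= muB by rewrite fine_ge0.
have l1 : 1 <= l by rewrite le_max lexx.
have [small|big] := leP (Num.min 1 C_K * C_F * Num.sqrt muB) eps.
  exists (Output (zero_tuple R d) 0); split => /=.
  - by apply: mulr_ge0; [exact: ltW|rewrite mul1r mulr_ge0 ?invr_ge0 ?sqr_ge0].
  - apply: mulr_ge0; first exact: ltW.
    apply: mulr_ge0; last exact: sqr_ge0.
    by apply: divr_ge0; apply: mulr_ge0 => //; exact: sqr_ge0.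
  under eq_integral do rewrite dotp0 addr0.
  apply: (zero_network_error s_gt1 A_gt0 M_ge0 Kext rep muB_lty _ _ small).
    exact: ltW.
  by move=> t tA; rewrite le_min K1//= KC.
have sq0 := sqrtr_ge0 muB.
have CF_gt0 : 0 < C_F.
  rewrite lt_neqAle CF0 andbT; apply: contraTneq big => <-.
  by rewrite mulr0 mul0r -leNgt ltW.
have sq_gt0 : 0 < Num.sqrt muB.
  rewrite lt_neqAle sq0 andbT; apply: contraTneq big => <-.
  by rewrite mulr0 -leNgt ltW.
have mu_gt0 : 0 < muB by rewrite -sqrtr_gt0.
have sqE : Num.sqrt muB ^+ 2 = muB by rewrite sqr_sqrtr.
pose rho := C_F * Num.sqrt muB / eps.
have rho0 : 0 < rho by rewrite divr_gt0// mulr_gt0.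
have rho1 : 1 <= rho.
  rewrite ler_pdivlMr// mul1r; apply: le_trans (ltW big) _.
  rewrite -mulrA ler_piMl ?ge_min ?lexx// mulr_ge0//.
have rho2 : rho ^+ 2 = C_F ^+ 2 * muB / eps ^+ 2 by rewrite !exprMn exprVn sqE.
pose N := Num.truncn (8 * rho ^+ 2).
have r2 : 0 <= 8 * rho ^+ 2 by rewrite mulr_ge0// exprn_ge0// ltW.
have N1 : 8 * rho ^+ 2 <= N.+1%:R by apply/ltW/real_truncnS_gt; exact: num_real.
have N2 : N.+1%:R <= 9 * rho ^+ 2 :> R.
  rewrite -natr1; have : N%:R <= 8 * rho ^+ 2 by rewrite truncn_le.
  have : 1 <= rho ^+ 2 by rewrite exprn_ege1.
  lra.
have x0 : 0 < C_F * C_K * Num.sqrt muB / eps by rewrite divr_gt0// !mulr_gt0.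
have [n [Hn1 Hn2]] := Hkap _ x0; rewrite -/l in Hn2.
have e1 : 8 * (C_F ^+ 2 * muB) <= N.+1%:R * eps ^+ 2.
  rewrite -ler_pdivrMr ?exprn_gt0//; apply: le_trans N1.
  by rewrite rho2 le_eqVlt; apply/orP; left; apply/eqP; ring.
have e2 : 6 * J%:R * C_K * C_F * Num.sqrt muB <= eps * 2 ^+ n.
  rewrite mulrC -ler_pdivrMl//; apply: le_trans Hn1.
  by rewrite le_eqVlt; apply/orP; left; apply/eqP; field; rewrite gt_eqF.
have [net [depthE sizeE err]] := sampled_network s_gt1 A_gt0 M_ge0 Kext rep muB_lty
  (ltW eps0) HJ K1 CF_gt0 mu_gt0 e1 e2.
have y1 : 1 <= kap * l by rewrite mulr_ege1.
have n0 : 0 <= n%:R :> R by [].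
have nn : n%:R * n%:R <= (kap * l) ^+ 2 by rewrite expr2 ler_pM.
have yy : kap * l <= (kap * l) ^+ 2 by rewrite expr2 ler_peMl//; lra.
exists net; split => //.
  rewrite depthE natrD natrM -natr1.
  have -> : 54 * J%:R * kap ^+ 2 * log2 s ^+ 2 * (1 / log2 s ^+ 2 * l ^+ 2)
    = 54 * J%:R * (kap * l) ^+ 2 by field; rewrite gt_eqF.
  apply: (@le_trans _ _ (54 * (kap * l) ^+ 2)); first lra.
  by rewrite ler_wpM2r ?sqr_ge0//; lra.
rewrite sizeE natrM natrM natrD natrM natrD natrM.
have -> : 54 * J%:R * kap ^+ 2 * log2 s ^+ 2 *
    (C_F ^+ 2 * muB / (eps ^+ 2 * log2 s ^+ 2) * l ^+ 2)
  = 9 * rho ^+ 2 * (J%:R * (6 * (kap * l) ^+ 2)).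
  by rewrite rho2; field; rewrite !gt_eqF.
apply: ler_pM => //; rewrite ?ler_wpM2l//; lra.
Qed.
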